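(* Let $\mathbf{Y}=\boldsymbol{\xi}+\boldsymbol{\omega}(\boldsymbol{\delta}U+\mathbf{Z})\sim\mathcal{MMNE}_p(\boldsymbol{\xi},\mathbf{\Omega},\boldsymbol{\delta})$ with $\boldsymbol{\delta}\neq\mathbf{0}$, where $U$ is standard exponential. Put $\mathbf{\Sigma}_{\mathbf{Y}}=\mathbf{\Omega}-\boldsymbol{\omega}\boldsymbol{\delta}\boldsymbol{\delta}^\top\boldsymbol{\omega}$, $\eta=\sqrt{\boldsymbol{\delta}^\top\boldsymbol{\omega}\mathbf{\Sigma}_{\mathbf{Y}}^{-1}\boldsymbol{\omega}\boldsymbol{\delta}}$ and, for $\mathbf{y}\in\mathbb{R}^p$, $A=A(\mathbf{y})=\eta^{-1}[\boldsymbol{\delta}^\top\boldsymbol{\omega}\mathbf{\Sigma}_{\mathbf{Y}}^{-1}(\mathbf{y}-\boldsymbol{\xi})-1]$. Then the conditional distribution of $U$ given $\mathbf{Y}=\mathbf{y}$ is $\mathcal{TN}(\eta^{-1}A,\eta^{-2},(0,\infty))$. Furthermore, $$\mathrm{E}[U\mid\mathbf{Y}=\mathbf{y}]=\eta^{-1}\Big(A+\frac{\phi(A)}{\Phi(A)}\Big),$$ and for $k\in\{2,3,\dots\}$, $$\mathrm{E}[U^k\mid\mathbf{Y}=\mathbf{y}]=A\eta^{-1}\,\mathrm{E}[U^{k-1}\mid\mathbf{Y}=\mathbf{y}]+(k-1)\eta^{-2}\,\mathrm{E}[U^{k-2}\mid\mathbf{Y}=\mathbf{y}].$$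
   Context: Let $\boldsymbol{\xi}\in\mathbb{R}^p$, $\mathbf{\Omega}$ a $p\times p$ symmetric positive definite matrix, $\boldsymbol{\omega}=\mathrm{diag}(\mathbf{\Omega}_{11}^{1/2},\dots,\mathbf{\Omega}_{pp}^{1/2})$, $\overline{\mathbf{\Omega}}=\boldsymbol{\omega}^{-1}\mathbf{\Omega}\boldsymbol{\omega}^{-1}$, $\boldsymbol{\delta}\in\mathbb{R}^p$ with $\overline{\mathbf{\Omega}}-\boldsymbol{\delta}\boldsymbol{\delta}^\top$ positive definite. $\mathcal{MMNE}_p(\boldsymbol{\xi},\mathbf{\Omega},\boldsymbol{\delta})$ denotes the law of $\boldsymbol{\xi}+\boldsymbol{\omega}(\boldsymbol{\delta}U+\mathbf{Z})$ where $U$ has density $e^{-u}$, $u>0$, and $\mathbf{Z}\sim\mathcal{N}_p(\mathbf{0},\overline{\mathbf{\Omega}}-\boldsymbol{\delta}\boldsymbol{\delta}^\top)$ is independent of $U$. $\mathcal{TN}(a,b,(0,\infty))$ is the normal distribution with mean $a$ and variance $b$ truncated to $(0,\infty)$. $\phi$ and $\Phi$ are the standard normal density and CDF. *)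

(* Defs.v *)
From HB Require Import structures.
From mathcomp Require Import all_boot all_order all_algebra.
From mathcomp Require Import all_classical all_reals all_analysis.
Set Implicit Arguments. Unset Strict Implicit. Unset Printing Implicit Defensive.
Import Order.TTheory GRing.Theory Num.Theory.
Import numFieldNormedType.Exports.
Local Open Scope classical_set_scope.
Local Open Scope ring_scope.

Section defs.
Context {R : realType}.

Definition sc (M : 'M[R]_1) : R := M ord0 ord0.

Definition spd (p : nat) (M : 'M[R]_p) : Prop :=
  M^T = M /\ forall x : 'cV[R]_p, x != 0 -> 0 < sc (x^T *m M *m x).

Definition omega_of (p : nat) (Om : 'M[R]_p) : 'M[R]_p :=
  \matrix_(i, j) (if i == j then Num.sqrt (Om i i) else 0).

Definition Ombar (p : nat) (Om : 'M[R]_p) : 'M[R]_p :=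
  invmx (omega_of Om) *m Om *m invmx (omega_of Om).

Definition SigmaY (p : nat) (Om : 'M[R]_p) (de : 'cV[R]_p) : 'M[R]_p :=
  Om - omega_of Om *m de *m de^T *m omega_of Om.

Definition eta_of (p : nat) (Om : 'M[R]_p) (de : 'cV[R]_p) : R :=
  Num.sqrt (sc (de^T *m omega_of Om *m invmx (SigmaY Om de) *m omega_of Om *m de)).

Definition A_of (p : nat) (xi : 'cV[R]_p) (Om : 'M[R]_p) (de : 'cV[R]_p)
    (y : 'cV[R]_p) : R :=
  (eta_of Om de)^-1 *
  (sc (de^T *m omega_of Om *m invmx (SigmaY Om de) *m (y - xi)) - 1).

Definition std_phi (x : R) : R := normal_pdf 0 1 x.
Definition std_Phi (x : R) : R :=
  fine (\int[@lebesgue_measure R]_(u in `]-oo, x]) (std_phi u)%:E)%E.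

(* density of TN(a, b, (0,oo)): normal with mean a and VARIANCE b, truncated *)
Definition tn_pdf (a b : R) (u : R) : R :=
  if 0 < u then normal_pdf a (Num.sqrt b) u / std_Phi (a / Num.sqrt b) else 0.

Definition tn_prob (a b : R) (B : set R) : \bar R :=
  (\int[@lebesgue_measure R]_(u in B) (tn_pdf a b u)%:E)%E.

Definition tn_moment (a b : R) (k : nat) : \bar R :=
  (\int[@lebesgue_measure R]_(u in [set: R]) ((u ^+ k) * tn_pdf a b u)%:E)%E.

(* The kernel y |-> TN(eta^{-1} A(y), eta^{-2}, (0,oo)) and the conditional
   moments E[U^k | Y = y] := \int u^k K(y, du) *)
Definition cond_kernel (p : nat) (xi : 'cV[R]_p) (Om : 'M[R]_p) (de : 'cV[R]_p)
    (y : 'cV[R]_p) : set R -> \bar R :=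
  tn_prob ((eta_of Om de)^-1 * A_of xi Om de y) ((eta_of Om de) ^- 2).

Definition cond_moment (p : nat) (xi : 'cV[R]_p) (Om : 'M[R]_p) (de : 'cV[R]_p)
    (k : nat) (y : 'cV[R]_p) : \bar R :=
  tn_moment ((eta_of Om de)^-1 * A_of xi Om de y) ((eta_of Om de) ^- 2) k.

Definition rect (p : nat) (C : 'I_p -> set R) : set 'cV[R]_p :=
  [set x | forall i, C i (x i ord0)].

End defs.

(* Main.v *)
(** Put [W = omega^-1 (Y - xi) = U de + Z], [G = Ombar - de de^T],
    [b = G^-1 de] and [S = b . W = eta^2 U + b . Z], so that
    [A(Y) = (S - 1) / eta].  For the pair [(U, S)] Bayes' formula is explicit:
    [e^-u] times the density of [N(eta^2 u, eta^2)] at [S] is, as a function of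
    [u > 0], proportional to the density of [N(A / eta, eta^-2)].

    To pass from [S] to [Y] we use that [S] is sufficient.  Only the laws of the
    projections [a . Z] are given, so this is done with Fourier transforms:
    [E (f(U) cos (a . W + th))] equals
    [E (f(U) cos ((a . de) U + th)) exp (- a^T G a / 2)], and comparing this for
    [a + r b] and [(s + r) b], where [s = (a . de) / eta^2], shows that
    [E (cos (a . W + th) | S)] is a constant multiple of [cos (s S + th)].
    Hence [1_B(U) - K(S, B)] is orthogonal to all [cos (a . W + th)], and so to
    the indicators of all boxes in [Y], by Fourier uniqueness applied one
    coordinate at a time.  In dimension one, uniqueness follows from Gaussian
    smoothing, the Gaussian being its own Fourier transform.

    The moments of the truncated normal law are computed by integrating the
    derivative of [u^k] times the normal density over the half-line. *)

Require Import Defs.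
From HB Require Import structures.
From mathcomp Require Import all_boot all_order all_algebra.
From mathcomp Require Import all_classical all_reals all_analysis.
From mathcomp Require Import measurable_realfun ring lra.
Set Implicit Arguments.
Unset Strict Implicit.
Unset Printing Implicit Defensive.
Import Order.TTheory GRing.Theory Num.Theory.
Import numFieldNormedType.Exports.
Local Open Scope classical_set_scope.
Local Open Scope ring_scope.

Section restricted_integral.
Context d (T : measurableType d) (R : realType) (mu : {measure set T -> \bar R}).

Lemma integral_indic_mul (D : set T) (f : T -> \bar R) :
  (\int[mu]_(x in D) f x = \int[mu]_x ((\1_D x)%:E * f x))%E.
Proof.
by rewrite integral_mkcond; apply: eq_integral => x _; rewrite epatch_indic muleC.
Qed.

Lemma Rintegral_mul_indic (D : set T) (f : T -> R) :
  \int[mu]_(x in D) f x = \int[mu]_x (f x * \1_D x).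
Proof. by rewrite Rintegral_mkcond patch_indic. Qed.

End restricted_integral.

Lemma Rintegral_probability_cst d (T : measurableType d) (R : realType)
    (P : probability T R) (c : R) :
  \int[P]_t c = c.
Proof. by rewrite Rintegral_cst//= probability_setT mulr1. Qed.

Section density.
Context d (T : measurableType d) (R : realType).
Variables (nu : {finite_measure set T -> \bar R}).
Variables (mu : {sigma_finite_measure set T -> \bar R}) (q : T -> R).
Hypotheses (mq : measurable_fun setT q) (q0 : forall x, 0 <= q x).
Hypothesis nuE : forall A, measurable A -> nu A = (\int[mu]_(x in A) (q x)%:E)%E.

Import Radon_Nikodym_SigmaFinite.

Lemma ge0_integral_density (f : T -> \bar R) :
  measurable_fun setT f -> (forall x, 0 <= f x)%E ->
  (\int[nu]_x f x = \int[mu]_x (f x * (q x)%:E))%E.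
Proof.
move=> mf f0.
have mqE : measurable_fun setT (EFin \o q) by exact/measurable_EFinP.
have numu : nu `<< mu.
  apply/null_content_dominatesP => A mA muA0.
  by rewrite nuE// null_set_integral//; exact: measurable_funTS.
rewrite -(change_of_variables numu)//.
have mRN : measurable_fun setT (Radon_Nikodym_SigmaFinite.f nu mu).
  exact: measurable_int (f_integrable numu).
apply: ge0_ae_eq_integral => //.
- exact: emeasurable_funM.
- exact: (emeasurable_funM mf mqE).
- by move=> x _; rewrite mule_ge0// f_ge0.
- by move=> x _; rewrite mule_ge0// lee_fin.
- apply: ae_eqe_mul2l; apply: integral_ae_eq => //; first exact: f_integrable.
  by move=> A _ mA; rewrite -f_integral// nuE.
Qed.

Lemma integral_density (f : T -> \bar R) : measurable_fun setT f ->
  (\int[nu]_x f x = \int[mu]_x (f x * (q x)%:E))%E.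
Proof.
move=> mf; rewrite [LHS]integralE [RHS]integralE.
rewrite !ge0_integral_density//; [|exact: measurable_funeneg|exact: measurable_funepos].
congr (_ - _)%E; apply: eq_integral => x _; rewrite (funeposE, funenegE).
  by rewrite funeposE maxe_pMl ?mul0e ?lee_fin.
by rewrite funenegE maxe_pMl ?mul0e ?lee_fin// mulNe.
Qed.

End density.

Section lebesgue_affine.
Context {R : realType}.
Notation mu := (@lebesgue_measure R).

Lemma measurable_affine (c d : R) : measurable_fun [set: R] (fun x => c * x + d).
Proof. by apply: measurable_funD => //; exact: measurable_funM. Qed.

Lemma lebesgue_measure_affine (c d : R) (A : set R) : 0 < c -> measurable A ->
  mu A = (c%:E * mu ((fun x => (c * x + d)%R) @^-1` A))%E.
Proof.
move=> c0 mA; pose phi : measurableTypeR R -> measurableTypeR R := fun x => c * x + d.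
have mphi : measurable_fun setT phi := measurable_affine c d.
apply: (@lebesgue_measure_unique _
  (mscale (NngNum (ltW c0)) (pushforward mu phi))) => //= _ [[a b]] _ <-.
rewrite /mscale/= /pushforward.
rewrite (_ : _ @^-1` _ = `](a - d) / c, (b - d) / c]%classic); last first.
  apply/seteqP; split => x /=; rewrite !in_itv/= ltr_pdivrMr// ler_pdivlMr//;
  by rewrite ltrBlDr lerBrDr mulrC.
rewrite !lebesgue_measure_itv/= !lte_fin ltr_pM2r ?invr_gt0// ltrD2r.
case: ifPn => ab; last by rewrite mule0.
by rewrite -!EFinB -EFinM -mulrBl mulrCA divff ?gt_eqF// mulr1; congr EFin; ring.
Qed.

Lemma ge0_integral_affine (c d : R) (f : R -> \bar R) : 0 < c ->
  measurable_fun setT f -> (forall x, 0 <= f x)%E ->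
  (\int[mu]_x f x = c%:E * \int[mu]_x f (c * x + d)%R)%E.
Proof.
move=> c0 mf f0; pose phi : measurableTypeR R -> measurableTypeR R := fun x => c * x + d.
have mphi : measurable_fun setT phi := measurable_affine c d.
rewrite -[X in (_ * X)%E](ge0_integral_pushforward mphi mu measurableT mf)//.
rewrite -(ge0_integral_mscale _ measurableT (NngNum (ltW c0)))//.
by apply: eq_measure_integral => A mA _; exact: lebesgue_measure_affine.
Qed.

End lebesgue_affine.

Section improper_integrals.
Context {R : realType}.
Notation mu := (@lebesgue_measure R).

Lemma cvg_integral_itvNn (D : set R) (f : R -> R) : measurable D ->
  mu.-integrable D (EFin \o f) ->
  (\int[mu]_(x in D `&` `[(- n%:R)%R, n%:R%R]) (f x)%:E)%E @[n --> \oo] -->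
  (\int[mu]_(x in D) (f x)%:E)%E.
Proof.
move=> mD intf.
have mf : measurable_fun D (EFin \o f) := measurable_int _ intf.
under eq_fun do rewrite integral_mkcondr.
apply: (@dominated_cvg _ _ _ mu D mD _ _ (abse \o (EFin \o f))) => //.
- by move=> n; apply/measurable_restrict => //; exact: measurable_funS mf.
- move=> x Dx; apply: cvg_near_cst; near=> n.
  rewrite patchE ifT// inE/= in_itv/= -ler_norml.
  near: n; exact: nbhs_infty_ger.
- exact: integrable_abse.
- move=> n x Dx; rewrite patchE; case: ifPn => // _.
  by rewrite abse0 abse_ge0.
Unshelve. all: by end_near. Qed.

Lemma integral_itv_derive (f F : R -> R) (a b : R) : a <= b ->
  continuous f -> (forall x : R, is_derive x 1 F (f x)) ->
  (\int[mu]_(x in `[a, b]) (f x)%:E = (F b - F a)%:E)%E.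
Proof.
move=> ab cf dF; have cF x : {for x, continuous F}.
  by apply: differentiable_continuous; apply/derivable1_diffP; have := dF x.
move: ab; rewrite le_eqVlt => /predU1P[<-|ab].
  by rewrite set_itv1 integral_set1 subrr.
rewrite (continuous_FTC2 ab (F := F)) ?EFinB//.
- exact: continuous_subspaceT.
- split.
  + by move=> x _; have := dF x.
  + by apply: cvg_at_right_filter; exact: cF.
  + by apply: cvg_at_left_filter; exact: cF.
- by move=> x _; rewrite derive1E derive_val.
Qed.

Lemma Rintegral_itvcy_derive (f F : R -> R) (a l : R) :
  continuous f -> mu.-integrable `[a, +oo[ (EFin \o f) ->
  (forall x : R, is_derive x 1 F (f x)) -> F n%:R @[n --> \oo] --> l ->
  \int[mu]_(x in `[a, +oo[) f x = l - F a.
Proof.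
move=> cf intf dF Fl.
have cvg_int := @cvg_integral_itvNn `[a, +oo[ f (measurable_itv _) intf.
rewrite /Rintegral (_ : integral _ _ _ = (l - F a)%:E)//.
apply: (cvg_unique _ cvg_int) => //.
have : (F n%:R - F a)%:E @[n --> \oo] --> (l - F a)%:E.
  by apply: cvg_EFin; [exact: nearW|apply: cvgB => //; exact: cvg_cst].
apply: cvg_trans.
apply: near_eq_cvg; near=> n.
have an : `|a| <= n%:R by near: n; exact: nbhs_infty_ger.
have /andP[Nna nea] : - n%:R <= a <= n%:R by rewrite -ler_norml.
rewrite -(integral_itv_derive nea cf dF); congr (integral _ _ _).
apply/seteqP; split => x /=; rewrite !in_itv/= ?andbT.
  by move=> /andP[ax ->]; rewrite ax (le_trans Nna ax).
by move=> [-> /andP[_ ->]].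
Unshelve. all: by end_near. Qed.

Lemma Rintegral_derive0 (f F : R -> R) :
  continuous f -> mu.-integrable setT (EFin \o f) ->
  (forall x : R, is_derive x 1 F (f x)) ->
  F n%:R @[n --> \oo] --> 0 -> F (- n%:R) @[n --> \oo] --> 0 ->
  \int[mu]_x f x = 0.
Proof.
move=> cf intf dF Fy0 FNy0.
have cvg_int := @cvg_integral_itvNn setT f measurableT intf.
rewrite /Rintegral (_ : integral _ _ _ = 0%E)//.
apply: (cvg_unique _ cvg_int) => //.
have : (F n%:R - F (- n%:R))%:E @[n --> \oo] --> 0%E.
  by apply: cvg_EFin; [exact: nearW|rewrite -[X in _ --> X](subrr 0); exact: cvgB].
apply: cvg_trans.
apply: near_eq_cvg; apply: nearW => n; rewrite setTI.
rewrite -(integral_itv_derive _ cf dF)//.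
by rewrite (@le_trans _ _ 0)// oppr_le0.
Qed.

End improper_integrals.

Section normal_density.
Context {R : realType}.
Notation mu := (@lebesgue_measure R).
Implicit Types a b c s t u x : R.

Lemma normal_pdf_expR a s x : s != 0 ->
  normal_pdf a s x = normal_peak s * expR (- (x - a) ^+ 2 / (s ^+ 2 *+ 2)).
Proof. by move=> s0; rewrite normal_pdfE. Qed.

Lemma normal_pdf_gt0 a s x : s != 0 -> 0 < normal_pdf a s x.
Proof. by move=> s0; rewrite normal_pdf_expR// mulr_gt0 ?normal_peak_gt0 ?expR_gt0. Qed.

Lemma normal_pdfC a s x : s != 0 -> normal_pdf a s x = normal_pdf x s a.
Proof. by move=> s0; rewrite !normal_pdf_expR// -opprB sqrrN. Qed.

Lemma normal_pdfN a s x : s != 0 -> normal_pdf a s (- x) = normal_pdf (- a) s x.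
Proof. by move=> s0; rewrite !normal_pdf_expR// -opprD sqrrN opprK. Qed.

Lemma normal_peakM c s : 0 < c -> c * normal_peak (c * s) = normal_peak s.
Proof.
move=> c0; rewrite /normal_peak exprMn -mulrA -mulrnAr sqrtrM ?sqr_ge0//.
by rewrite sqrtr_sqr gtr0_norm// invfM mulrA divff ?gt_eqF// mul1r.
Qed.

Lemma normal_pdf_affine a s c d x : 0 < c -> s != 0 ->
  c * normal_pdf (c * a + d) (c * s) (c * x + d) = normal_pdf a s x.
Proof.
move=> c0 s0; have cN0 : c != 0 by rewrite gt_eqF.
rewrite !normal_pdf_expR ?mulf_neq0// mulrA normal_peakM//; congr (_ * expR _).
by field; rewrite s0 cN0.
Qed.

Lemma normal_pdf_tilt a s t u : s != 0 -> expR (t * u) * normal_pdf a s u =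
  expR (t * a + (t * s) ^+ 2 / 2) * normal_pdf (a + t * s ^+ 2) s u.
Proof.
move=> s0; rewrite !normal_pdf_expR// [LHS]mulrCA [RHS]mulrCA -!expRD.
by congr (_ * expR _); field.
Qed.

Lemma measurable_normal_pdf_pair s : s != 0 ->
  measurable_fun setT (fun z : R * R => normal_pdf z.1 s z.2).
Proof.
move=> s0; under eq_fun do rewrite normal_pdf_expR//.
apply: measurable_funM => //; apply: measurableT_comp => //.
apply: measurable_funM => //; apply: measurableT_comp => //.
by apply: measurable_funX; exact: measurable_funB.
Qed.

Lemma measurable_EFin_normal_pdf a s :
  measurable_fun [set: R] (fun x : R => (normal_pdf a s x)%:E).
Proof. by apply/measurable_EFinP; exact: measurable_normal_pdf. Qed.

Lemma measurable_normal_prob s (D : set R) : s != 0 -> measurable D ->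
  measurable_fun setT (fun a => normal_prob a s D).
Proof.
move=> s0 mD.
pose f (z : R * measurableTypeR R) := ((\1_D (z.2 : R))%:E * (normal_pdf z.1 s z.2)%:E)%E.
under eq_fun do rewrite /normal_prob integral_indic_mul.
apply: (@measurable_fun_fubini_tonelli_F _ _ R (measurableTypeR R) R mu f).
  apply: emeasurable_funM; apply/measurable_EFinP.
    exact: measurableT_comp (measurable_indic mD) measurable_snd.
  exact: measurable_normal_pdf_pair.
by move=> z; rewrite mule_ge0 ?lee_fin ?normal_pdf_ge0.
Qed.

Lemma is_derive_normal_pdf a s x : s != 0 ->
  is_derive x 1 (normal_pdf a s) (- (x - a) / s ^+ 2 * normal_pdf a s x).
Proof.
move=> s0.
rewrite (_ : normal_pdf a s =
    fun x => normal_peak s * expR (- (x - a) ^+ 2 / (s ^+ 2 *+ 2))); last first.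
  by apply/funext => u; rewrite normal_pdf_expR.
by apply: is_derive_eq; rewrite /GRing.scale/=; field.
Qed.

Lemma ge0_integral_normal_affine a s c d (f : R -> \bar R) : 0 < c -> s != 0 ->
  measurable_fun setT f -> (forall x, 0 <= f x)%E ->
  (\int[mu]_u (f u * (normal_pdf (c * a + d) (c * s) u)%:E) =
   \int[mu]_v (f (c * v + d)%R * (normal_pdf a s v)%:E))%E.
Proof.
move=> c0 s0 mf f0.
have mfn : measurable_fun setT
    (fun u => f u * (normal_pdf (c * a + d) (c * s) u)%:E)%E.
  exact: (emeasurable_funM mf (measurable_EFin_normal_pdf _ _)).
have fn0 u : (0 <= f u * (normal_pdf (c * a + d) (c * s) u)%:E)%E.
  by rewrite mule_ge0// lee_fin normal_pdf_ge0.
rewrite (ge0_integral_affine d c0 mfn fn0) -ge0_integralZl//.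
- apply: eq_integral => x _.
  by rewrite muleCA -EFinM normal_pdf_affine.
- exact: (measurableT_comp mfn (measurable_affine c d)).
- by rewrite lee_fin ltW.
Qed.

End normal_density.

Section standard_normal_cdf.
Context {R : realType}.
Notation mu := (@lebesgue_measure R).
Implicit Types a b s x : R.

Let id_std_normal : {RV (@normal_prob R 0 1) >-> R} :=
  HB.pack (idfun : measurableTypeR R -> R)
    (isMeasurableFun.Build _ _ (measurableTypeR R) R idfun (@measurable_id _ _ setT)).

Let std_Phi_cdf : EFin \o @std_Phi R = cdf id_std_normal.
Proof.
apply/funext => x /=; rewrite fineK//.
exact: (fin_num_measure (normal_prob 0 1) _ (measurable_itv _)).
Qed.

Lemma std_PhiE x : (std_Phi x)%:E = normal_prob 0 1 `]-oo, x].
Proof. by rewrite -[LHS]/((EFin \o @std_Phi R) x) std_Phi_cdf. Qed.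

Lemma std_Phi_ge0 x : 0 <= std_Phi x.
Proof. by rewrite -lee_fin std_PhiE. Qed.

Lemma std_Phi_le1 x : std_Phi x <= 1.
Proof. by rewrite -lee_fin std_PhiE probability_le1. Qed.

Lemma measurable_std_Phi : measurable_fun setT (@std_Phi R).
Proof. by apply/measurable_EFinP; rewrite std_Phi_cdf; exact: cdf_measurable. Qed.

Lemma measurable_inv_std_Phi : measurable_fun setT (fun x : R => (std_Phi x)^-1).
Proof.
under eq_fun do rewrite -powR_inv1 ?std_Phi_ge0//.
exact: measurableT_comp (measurable_powR _) measurable_std_Phi.
Qed.

Lemma cvg_std_Phiy : @std_Phi R x @[x --> +oo] --> (1 : R).
Proof. by have := cvg_cdfy1 id_std_normal; rewrite -std_Phi_cdf => /fine_cvg. Qed.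

Lemma cvg_std_PhiNy : @std_Phi R x @[x --> -oo] --> (0 : R).
Proof. by have := cvg_cdfNy0 id_std_normal; rewrite -std_Phi_cdf => /fine_cvg. Qed.

Lemma std_Phi_gt0 x : 0 < std_Phi x.
Proof.
rewrite lt_neqAle std_Phi_ge0 andbT eq_sym; apply/eqP => Phi0.
have : (\int[mu]_(u in `]-oo, x]) `|(normal_pdf 0 1 u)%:E| = 0)%E.
  under eq_integral do rewrite gee0_abs ?lee_fin ?normal_pdf_ge0//.
  by rewrite -[LHS]/(normal_prob 0 1 _) -std_PhiE Phi0.
have mpdf := measurable_funS measurableT (@subsetT _ `]-oo, x])
  (measurable_EFin_normal_pdf 0 1).
move=> /(ae_eq_integral_abs mu (measurable_itv _) mpdf)[N [mN N0 subN]].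
suff : (mu `]-oo, x] <= mu N)%E by rewrite N0 lebesgue_measure_itv/= ltNyr.
apply: le_measure; rewrite ?inE//; apply: subset_trans subN => u ux /(_ ux)[] /eqP.
by rewrite gt_eqF// normal_pdf_gt0// oner_neq0.
Qed.

Lemma normal_prob_itvNyc a s b : 0 < s ->
  normal_prob a s `]-oo, b] = (std_Phi ((b - a) / s))%:E.
Proof.
move=> s0; rewrite [RHS]std_PhiE /normal_prob [LHS]integral_indic_mul [RHS]integral_indic_mul.
have mD : measurable_fun setT (fun u : R => (\1_(`]-oo, b]) u)%:E : \bar R).
  exact/measurable_EFinP/measurable_indic.
have := ge0_integral_normal_affine 0 a s0 (oner_neq0 R) mD.
rewrite mulr0 add0r mulr1 => -> //; apply: eq_integral => v _; congr (_%:E * _)%E.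
by rewrite !indicE !mem_setE !in_itv/= ler_pdivlMr// lerBrDr mulrC.
Qed.

Lemma normal_prob_itv0y a s : 0 < s ->
  normal_prob a s `]0, +oo[ = (std_Phi (a / s))%:E.
Proof.
move=> s0; have -> : a / s = (0 - - a) / s by rewrite sub0r opprK.
rewrite -[RHS](normal_prob_itvNyc _ _ s0).
rewrite /normal_prob integral_itv_obnd_cbnd; last first.
  by apply: measurable_funTS; exact: measurable_EFin_normal_pdf.
rewrite ge0_integration_by_substitution0.
- by apply: eq_integral => u _; rewrite normal_pdfN ?gt_eqF.
- exact: measurable_EFin_normal_pdf.
- by move=> u; rewrite lee_fin normal_pdf_ge0.
Qed.

Lemma normal_prob_itvoc a s x y : 0 < s -> x <= y ->
  normal_prob a s `]x, y] = (std_Phi ((y - a) / s) - std_Phi ((x - a) / s))%:E.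
Proof.
move=> s0 xy; rewrite EFinB -!(normal_prob_itvNyc _ _ s0).
rewrite (_ : `]-oo, y]%classic = `]-oo, x]%classic `|` `]x, y]%classic); last first.
  by rewrite -itv_bndbnd_setU ?bnd_simp.
rewrite measureU//; last first.
  apply/seteqP; split => z //=; rewrite !in_itv/=.
  by move=> -[/le_lt_trans zx /andP[/zx]]; rewrite ltxx.
rewrite -[LHS](@addeK _ (normal_prob a s `]-oo, x])); last by rewrite fin_num_measure.
by congr (_ - _)%E; exact: addeC.
Qed.

End standard_normal_cdf.

Section normal_moments.
Context {R : realType}.
Notation mu := (@lebesgue_measure R).
Implicit Types a s u : R.

Lemma normr_exp_le_expR k u : `|u| ^+ k <= k`!%:R * (expR u + expR (- u)).
Proof.
have expR_abs_le : expR `|u| <= expR u + expR (- u).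
  by case: (ger0P u) => _; rewrite (lerDl, lerDr) expR_ge0.
apply: (@le_trans _ _ (k`!%:R * expR `|u|)); last by rewrite ler_wpM2l.
case: k => [|k]; first by rewrite expr0 mul1r -expR0 ler_expR.
rewrite mulrC -ler_pdivrMr ?ltr0n ?fact_gt0//.
by apply: le_trans (expR_ge1Dxn k (normr_ge0 u)); rewrite lerDr.
Qed.

Lemma normr_exp_normal_le a s k u : s != 0 -> `|u| ^+ k * normal_pdf a s u <=
  k`!%:R * (expR (a + s ^+ 2 / 2) * normal_pdf (a + s ^+ 2) s u +
            expR (- a + s ^+ 2 / 2) * normal_pdf (a - s ^+ 2) s u).
Proof.
move=> s0; apply: le_trans (ler_wpM2r (normal_pdf_ge0 _ _ _) (normr_exp_le_expR k u)) _.
have := normal_pdf_tilt a 1 u s0; rewrite !mul1r => <-.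
have := normal_pdf_tilt a (- 1) u s0; rewrite !mulN1r sqrrN => <-.
by rewrite -mulrDl mulrA.
Qed.

Lemma integrable_exp_normal a s k : s != 0 ->
  mu.-integrable setT (fun u : R => (u ^+ k * normal_pdf a s u)%:E).
Proof.
move=> s0; pose bound u :=
  (k`!%:R%:E * ((expR (a + s ^+ 2 / 2))%:E * (normal_pdf (a + s ^+ 2) s u)%:E +
                (expR (- a + s ^+ 2 / 2))%:E * (normal_pdf (a - s ^+ 2) s u)%:E))%E.
have ibound : mu.-integrable setT bound.
  apply: integrableZl => //; apply: integrableD => //;
    by apply: integrableZl => //; exact: integrable_normal_pdf.
apply: le_integrable ibound => //.
- apply/measurable_EFinP; apply: measurable_funM; first exact: measurable_funX.
  exact: measurable_normal_pdf.
- move=> u _; apply: le_trans (lee_abs _).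
  rewrite abse_EFin normrM normrX (ger0_norm (normal_pdf_ge0 _ _ _)).
  by rewrite lee_fin normr_exp_normal_le.
Qed.

Lemma cvg_normal_pdfy a s : s != 0 -> normal_pdf a s n%:R @[n --> \oo] --> 0.
Proof.
move=> s0; have d0 : 0 < s ^+ 2 *+ 2 by rewrite mulrn_wgt0// exprn_even_gt0.
rewrite (_ : (fun n => _) = (fun n => normal_peak s *
   gauss_fun ((n%:R - a) / Num.sqrt (s ^+ 2 *+ 2)))); last first.
  apply/funext => n; rewrite normal_pdf_expR//; congr (_ * expR _).
  by rewrite expr_div_n sqr_sqrtr ?mulNr// ltW.
rewrite -[X in _ --> X](mulr0 (normal_peak s)); apply: cvgMr.
apply: (cvg_comp (fun n : nat => (n%:R - a) / Num.sqrt (s ^+ 2 *+ 2))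
  gauss_fun) cvg_gauss_fun.
apply: (cvg_comp (fun n : nat => n%:R) (fun r : R => (r - a) / Num.sqrt (s ^+ 2 *+ 2))
  cvgr_idn).
by apply: gt0_cvgMly; [rewrite invr_gt0 sqrtr_gt0|exact: cvg_addrr].
Qed.

Lemma cvg_exp_normal_pdfy a s k : s != 0 ->
  n%:R ^+ k * normal_pdf a s n%:R @[n --> \oo] --> 0.
Proof.
move=> s0; apply: (@squeeze_cvgr _ _ _ _ (fun=> 0) (fun n : nat => k`!%:R *
    (expR (a + s ^+ 2 / 2) * normal_pdf (a + s ^+ 2) s n%:R +
     expR (- a + s ^+ 2 / 2) * normal_pdf (a - s ^+ 2) s n%:R))).
- apply: nearW => n; rewrite mulr_ge0 ?exprn_ge0 ?normal_pdf_ge0//=.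
  by have := normr_exp_normal_le a k n%:R s0; rewrite normr_nat.
- exact: cvg_cst.
- rewrite -[X in _ --> X](mulr0 k`!%:R); apply: cvgMr.
  rewrite -[X in _ --> X]addr0; apply: cvgD.
    rewrite -[X in _ --> X](mulr0 (expR (a + s ^+ 2 / 2))).
    by apply: cvgMr; exact: cvg_normal_pdfy.
  rewrite -[X in _ --> X](mulr0 (expR (- a + s ^+ 2 / 2))).
  by apply: cvgMr; exact: cvg_normal_pdfy.
Qed.

End normal_moments.

Section normal_characteristic_function.
Context {R : realType}.
Notation mu := (@lebesgue_measure R).

Lemma integrable_exp_normal_bounded (f : R -> R) (M a s : R) (k : nat) : s != 0 ->
  measurable_fun setT f -> (forall x, `|f x| <= M) ->
  mu.-integrable setT (fun x => (x ^+ k * normal_pdf a s x * f x)%:E).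
Proof.
move=> s0 mf fM; apply: (integrableMl measurableT (integrable_exp_normal a k s0) mf).
by exists M; split; [exact: num_real|move=> N /ltW MN x _; exact: le_trans (fM x) MN].
Qed.

Lemma integrable_normal_bounded (f : R -> R) (M a s : R) : s != 0 ->
  measurable_fun setT f -> (forall x, `|f x| <= M) ->
  mu.-integrable setT (fun x => (normal_pdf a s x * f x)%:E).
Proof.
move=> s0 mf fM; have := integrable_exp_normal_bounded a 0 s0 mf fM.
by under eq_fun do rewrite expr0 mul1r.
Qed.

Lemma Rintegral_normal_prob (a s : R) (f : R -> R) : measurable_fun setT f ->
  \int[normal_prob a s]_x f x = \int[mu]_x (normal_pdf a s x * f x).
Proof.
move=> mf; have mfE : measurable_fun setT (EFin \o f) by exact/measurable_EFinP.
rewrite /Rintegral (@integral_density _ _ _ (normal_prob a s) mu _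
  (measurable_normal_pdf a s) (normal_pdf_ge0 a s) (fun A _ => erefl) _ mfE).
by congr fine; apply: eq_integral => x _; rewrite muleC -EFinM.
Qed.

Lemma stein_normal (s M : R) (f f' : R -> R) : s != 0 ->
  continuous f -> continuous f' -> (forall x, `|f x| <= M) -> (forall x, `|f' x| <= M) ->
  (forall x : R, is_derive x 1 f (f' x)) ->
  \int[mu]_x (x * normal_pdf 0 s x * f x) =
  s ^+ 2 * \int[mu]_x (normal_pdf 0 s x * f' x).
Proof.
move=> s0 cf cf' fM f'M df; set q := normal_pdf 0 s.
have cq : continuous q by exact: continuous_normal_pdf.
have mf := continuous_measurable_fun cf; have mf' := continuous_measurable_fun cf'.
have qf_cvg0 (r : nat -> R) : q (r n) @[n --> \oo] --> 0 ->
    s ^+ 2 * (q (r n) * f (r n)) @[n --> \oo] --> 0.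
  move=> q0; rewrite -[X in _ --> X](mulr0 (s ^+ 2)); apply: cvgMr.
  have qM_cvg0 : q (r n) * M @[n --> \oo] --> 0.
    by rewrite -[X in _ --> X](mul0r M); exact: cvgMl.
  apply/norm_cvg0P; apply: (squeeze_cvgr _ (cvg_cst 0) qM_cvg0).
  apply: nearW => n; rewrite normr_ge0 normrM ger0_norm ?normal_pdf_ge0//=.
  by rewrite ler_wpM2l ?normal_pdf_ge0.
have i1 := integrable_exp_normal_bounded 0 1 s0 mf fM.
have i0 := integrable_normal_bounded 0 s0 mf' f'M.
have is0 := integrableZl measurableT (s ^+ 2) i0.
have : \int[mu]_x (s ^+ 2 * (q x * f' x) - x * q x * f x) = 0.
  apply: (@Rintegral_derive0 _ _ (fun x => s ^+ 2 * (q x * f x))).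
  - move=> x; apply: cvgB; first by apply: cvgMr; apply: cvgM; [exact: cq|exact: cf'].
    by apply: cvgM; [apply: cvgM; [exact: cvg_id|exact: cq]|exact: cf].
  - exact: (integrableB measurableT is0 i1).
  - move=> x; have dq : is_derive x 1 q (- x / s ^+ 2 * q x).
      by have := is_derive_normal_pdf 0 x s0; rewrite subr0.
    by apply: is_derive_eq; rewrite /GRing.scale/=; field.
  - by apply: qf_cvg0; exact: cvg_normal_pdfy.
  - apply: qf_cvg0; rewrite /q; under eq_fun do rewrite normal_pdfN// oppr0.
    exact: cvg_normal_pdfy.
rewrite (RintegralB measurableT is0 i1) (RintegralZl _ measurableT i0).
by move/eqP; rewrite subr_eq0 => /eqP ->.
Qed.

Lemma measurable_cos_affine (t th : R) : measurable_fun setT (fun x : R => cos (t * x + th)).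
Proof.
apply: measurableT_comp (measurable_affine t th).
by apply: continuous_measurable_fun; exact: continuous_cos.
Qed.

Lemma continuous_affine (t th : R) : continuous (fun x : R => t * x + th).
Proof. by move=> x; apply: cvgD; [apply: cvgMr; exact: cvg_id|exact: cvg_cst]. Qed.

Lemma is_derive_normal_cos (s th t : R) : s != 0 ->
  is_derive t 1 (fun u => \int[mu]_x (normal_pdf 0 s x * cos (u * x + th)))
    (- \int[mu]_x (x * normal_pdf 0 s x * sin (t * x + th))).
Proof.
move=> s0; pose q := normal_pdf 0 s; pose f u x : R := q x * cos (u * x + th).
have msin u : measurable_fun setT (fun x : R => sin (u * x + th)).
  apply: measurableT_comp (measurable_affine u th).
  by apply: continuous_measurable_fun; exact: continuous_sin.
have isin := integrable_exp_normal_bounded 0 1 s0 (msin t) (fun x => sin_max _).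
have icos u := integrable_normal_bounded 0 s0 (measurable_cos_affine u th)
  (fun x => cos_max _).
have df (u x : R) : is_derive u 1 (f^~ x) (- (x * q x * sin (u * x + th))).
  by apply: is_derive_eq; rewrite /GRing.scale/=; ring.
have partial1f (u x : R) : partial1of2 f u x = - (x * q x * sin (u * x + th)).
  by rewrite partial1of2E; exact: derive_val.
have ibound : mu.-integrable setT (EFin \o (fun x : R => `|x * q x|)).
  exact: integrable_norm (integrable_exp_normal 0 1 s0).
have tI : `]t - 1, t + 1[%classic t by rewrite /= in_itv/= ltrBlDr !ltrDl ltr01.
have f_bound (u x : R) : `]t - 1, t + 1[%classic u -> [set: R] x ->
    `|partial1of2 f u x| <= `|x * q x|.
  by move=> _ _; rewrite partial1f normrN [leLHS]normrM ler_piMr// sin_max.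
have derf (u x : R) (_ : `]t - 1, t + 1[%classic u) (_ : [set: R] x) :=
  @ex_derive _ _ _ _ _ _ _ (df u x).
apply: DeriveDef.
  exact: (derivable_under_integral measurableT tI (fun u _ => icos u) derf _ ibound f_bound).
rewrite -derive1E (differentiation_under_integral measurableT tI (fun u _ => icos u)
  derf _ ibound f_bound)// -mulN1r -(RintegralZl _ measurableT isin).
by apply: eq_Rintegral => x _; rewrite partial1f mulN1r.
Qed.

(* The characteristic function of a centred normal law satisfies
   [psi' = - s ^+ 2 * t * psi] by Stein's identity. *)
Lemma normal_prob_cos (s th t : R) : s != 0 ->
  \int[normal_prob 0 s]_x cos (t * x + th) = expR (- (s * t) ^+ 2 / 2) * cos th.
Proof.
move=> s0; rewrite (Rintegral_normal_prob _ _ (measurable_cos_affine t th)).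
pose psi u := \int[mu]_x (normal_pdf 0 s x * cos (u * x + th)).
have dpsi (u : R) : is_derive u 1 psi (- (s ^+ 2 * u * psi u)).
  suff <- : \int[mu]_x (x * normal_pdf 0 s x * sin (u * x + th)) = s ^+ 2 * u * psi u.
    exact: is_derive_normal_cos.
  transitivity (s ^+ 2 * \int[mu]_x (normal_pdf 0 s x * (u * cos (u * x + th)))).
    apply: (@stein_normal s (1 + `|u|)) => // x.
    - by apply: continuous_comp; [exact: continuous_affine|exact: continuous_sin].
    - apply: cvgMr.
      by apply: continuous_comp; [exact: continuous_affine|exact: continuous_cos].
    - by rewrite (le_trans (sin_max _))// lerDl.
    - by rewrite normrM ler_wpDl// ler_piMr// cos_max.
    - by apply: is_derive_eq; rewrite /GRing.scale/=; ring.
  rewrite -[RHS]mulrA -(RintegralZl _ measurableT (integrable_normal_bounded 0 s0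
    (measurable_cos_affine u th) (fun x => cos_max _))).
  by congr (_ * _); apply: eq_Rintegral => x _; exact: mulrCA.
have dG (u : R) : is_derive u 1 (fun u => psi u * expR ((s * u) ^+ 2 / 2)) 0.
  by have := dpsi u => dpsi_u; apply: is_derive_eq; rewrite /GRing.scale/=; field.
have psi0 : psi 0 = cos th.
  rewrite /psi -(Rintegral_normal_prob _ _ (measurable_cos_affine 0 th)).
  under eq_Rintegral do rewrite mul0r add0r.
  exact: (Rintegral_probability_cst (normal_prob 0 s)).
have /= := is_derive_0_is_cst t 0 dG.
rewrite mulr0 expr0n mul0r expR0 mulr1 psi0 => <-.
by rewrite mulrCA -expRD mulNr addNr expR0 mulr1.
Qed.

End normal_characteristic_function.

Section bounded_measurable.
Context d (T : measurableType d) (R : realType).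
Implicit Types f g : T -> R.

Definition bounded_measurable f :=
  measurable_fun setT f /\ exists M, forall t, `|f t| <= M.

Lemma bounded_measurable_cst (c : R) : bounded_measurable (fun=> c).
Proof. by split; [exact: measurable_cst|exists `|c|]. Qed.

Lemma bounded_measurableM f g : bounded_measurable f -> bounded_measurable g ->
  bounded_measurable (fun t => f t * g t).
Proof.
move=> [mf [M fM]] [mg [N gN]]; split; first exact: measurable_funM.
by exists (M * N) => t; rewrite normrM ler_pM.
Qed.

Lemma bounded_measurableZ c f : bounded_measurable f ->
  bounded_measurable (fun t => c * f t).
Proof. exact/bounded_measurableM/bounded_measurable_cst. Qed.

Lemma bounded_measurableD f g : bounded_measurable f -> bounded_measurable g ->
  bounded_measurable (fun t => f t + g t).
Proof.
move=> [mf [M fM]] [mg [N gN]]; split; first exact: measurable_funD.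
by exists (M + N) => t; rewrite (le_trans (ler_normD _ _))// lerD.
Qed.

Lemma bounded_measurableB f g : bounded_measurable f -> bounded_measurable g ->
  bounded_measurable (fun t => f t - g t).
Proof.
move=> [mf [M fM]] [mg [N gN]]; split; first exact: measurable_funB.
by exists (M + N) => t; rewrite (le_trans (ler_normB _ _))// lerD.
Qed.

Lemma normr_indic_le1 (A : set T) t : `|\1_A t : R| <= 1.
Proof. by rewrite indicE; case: (_ \in _); rewrite ?normr1 ?normr0. Qed.

Lemma bounded_measurable_indic (A : set T) : measurable A ->
  bounded_measurable (\1_A : T -> R).
Proof. by split; [exact: measurable_indic|exists 1; exact: normr_indic_le1]. Qed.

Lemma bounded_measurable_cos f : measurable_fun setT f ->
  bounded_measurable (fun t => cos (f t)).
Proof.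
move=> mf; split; last by exists 1 => t; exact: cos_max.
by apply: measurableT_comp mf; apply: continuous_measurable_fun; exact: continuous_cos.
Qed.

End bounded_measurable.

Lemma bounded_measurable_comp d d' (T : measurableType d) (S : measurableType d')
    (R : realType) (f : S -> R) (X : T -> S) :
  bounded_measurable f -> measurable_fun setT X -> bounded_measurable (fun t => f (X t)).
Proof.
by move=> [mf [M fM]] mX; split; [exact: measurableT_comp|exists M => t].
Qed.

Section bounded_expectation.
Context d (T : measurableType d) (R : realType) (P : probability T R).
Implicit Types f g : T -> R.

Lemma bounded_measurable_integrable f : bounded_measurable f ->
  P.-integrable setT (EFin \o f).
Proof.
move=> [mf [M fM]]; apply: measurable_bounded_integrable => //.
  by rewrite /= probability_setT ltry.
by exists M; split; [exact: num_real|move=> N /ltW MN t _; exact: le_trans (fM t) MN].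
Qed.

Lemma EFin_bounded_Rintegral f : bounded_measurable f ->
  (\int[P]_t f t)%:E = (\int[P]_t (f t)%:E)%E.
Proof.
move=> bf; rewrite /Rintegral fineK//; apply: integrable_fin_num => //.
exact: bounded_measurable_integrable.
Qed.

Lemma bounded_RintegralD f g : bounded_measurable f -> bounded_measurable g ->
  \int[P]_t (f t + g t) = \int[P]_t f t + \int[P]_t g t.
Proof. by move=> bf bg; rewrite RintegralD//; exact: bounded_measurable_integrable. Qed.

Lemma bounded_RintegralB f g : bounded_measurable f -> bounded_measurable g ->
  \int[P]_t (f t - g t) = \int[P]_t f t - \int[P]_t g t.
Proof. by move=> bf bg; rewrite RintegralB//; exact: bounded_measurable_integrable. Qed.

Lemma bounded_RintegralZ c f : bounded_measurable f ->
  \int[P]_t (c * f t) = c * \int[P]_t f t.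
Proof. by move=> bf; rewrite RintegralZl//; exact: bounded_measurable_integrable. Qed.

Lemma bounded_convergence (M : R) (f_ : nat -> T -> R) f :
  (forall n, measurable_fun setT (f_ n)) -> (forall n t, `|f_ n t| <= M) ->
  (forall t, f_ n t @[n --> \oo] --> f t) ->
  \int[P]_t f_ n t @[n --> \oo] --> \int[P]_t f t.
Proof.
move=> mf_ f_M f_cvg.
have mf : measurable_fun setT f by exact: (measurable_fun_cvg mf_ (fun t _ => f_cvg t)).
have [|||||/(integrable_fin_num measurableT) fin_f _] := @dominated_convergence _ _ _ P
  setT measurableT (fun n t => (f_ n t)%:E) (EFin \o f) (cst M%:E).
- by move=> n; exact/measurable_EFinP.
- exact/measurable_EFinP.
- by apply: aeW => t _; apply: cvg_EFin; [exact: nearW|exact: f_cvg].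
- exact: finite_measure_integrable_cst.
- by apply: aeW => t n _; rewrite abse_EFin lee_fin.
by rewrite -[X in _ --> X -> _](fineK fin_f) => /fine_cvg.
Qed.

Lemma Rintegral_distribution d' (S : measurableType d') (X : {RV P >-> S}) (g : S -> R) :
  bounded_measurable g -> \int[P]_t g (X t) = \int[distribution P X]_x g x.
Proof.
move=> bg; rewrite /Rintegral integral_distribution//.
  by apply/measurable_EFinP; exact: bg.1.
by apply: bounded_measurable_integrable; exact: bounded_measurable_comp bg _.
Qed.

End bounded_expectation.

Section bounded_fubini.
Context d1 d2 (T1 : measurableType d1) (T2 : measurableType d2) (R : realType).
Variables (P : probability T1 R) (Q : probability T2 R) (h : T1 * T2 -> R).
Hypothesis bh : bounded_measurable h.

Let bounded_section1 x : bounded_measurable (fun y => h (x, y)).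
Proof. exact: bounded_measurable_comp bh (pair1_measurable x). Qed.

Let bounded_section2 y : bounded_measurable (fun x => h (x, y)).
Proof. exact: bounded_measurable_comp bh (pair2_measurable y). Qed.

Lemma Rintegral_prod1 : \int[(P \x Q)%E]_z h z = \int[P]_x \int[Q]_y h (x, y).
Proof.
congr fine; rewrite -integral12_prod_meas1; last exact: bounded_measurable_integrable.
by apply: eq_integral => x _; rewrite EFin_bounded_Rintegral.
Qed.

Lemma Rintegral_prod2 : \int[(P \x Q)%E]_z h z = \int[Q]_y \int[P]_x h (x, y).
Proof.
congr fine; rewrite -integral21_prod_meas1; last exact: bounded_measurable_integrable.
by apply: eq_integral => y _; rewrite EFin_bounded_Rintegral.
Qed.

Lemma Rintegral_fubini :
  \int[P]_x \int[Q]_y h (x, y) = \int[Q]_y \int[P]_x h (x, y).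
Proof. by rewrite -Rintegral_prod1 Rintegral_prod2. Qed.

Lemma bounded_measurable_Rintegral : bounded_measurable (fun x => \int[Q]_y h (x, y)).
Proof.
split.
  apply: measurableT_comp => //.
  exact: measurable_fubini_F (bounded_measurable_integrable (P \x Q)%E bh).
have [mh [M hM]] := bh; exists M => x.
have ih := bounded_measurable_integrable Q (bounded_section1 x).
rewrite (le_trans (le_normr_Rintegral measurableT ih))//.
rewrite -[leRHS](Rintegral_probability_cst Q) le_Rintegral//.
- exact: integrable_norm.
- exact: finite_measure_integrable_cst.
Qed.

End bounded_fubini.

Lemma uniform_prob_itvNyo (R : realType) (a b y : R) (ab : a < b) : a <= y <= b ->
  uniform_prob ab `]-oo, y[ = ((y - a) / (b - a))%:E.
Proof.
move=> /andP[ay yb]; rewrite /uniform_prob integral_uniform_pdf.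
rewrite (eq_integral (fun=> (b - a)^-1%:E)); last first.
  by move=> x; rewrite inE/= !in_itv/= /uniform_pdf => -[_ ->].
rewrite integral_cst//=; last exact: measurableI.
rewrite (_ : _ `&` _ = `[a, y[%classic); last first.
  apply/seteqP; split => x /=; rewrite !in_itv/=; first by move=> [-> /andP[->]].
  by move=> /andP[-> xy]; rewrite xy/= ltW// (lt_le_trans xy).
rewrite lebesgue_measure_itv/= lte_fin mulrC.
by have [_|ya] := ltP a y; rewrite // (@le_anti _ _ a y) ?ay// subrr mulr0 mule0.
Qed.

Section vanishing_integrals.
Context d (T : measurableType d) (R : realType).

Lemma Rintegral0_g_sigma (mu : {measure set T -> \bar R}) (G : set (set T)) (H : T -> R) :
  mu.-integrable setT (EFin \o H) -> G `<=` measurable -> setI_closed G ->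
  \int[mu]_t H t = 0 -> (forall A, G A -> \int[mu]_(t in A) H t = 0) ->
  forall A, <<s G >> A -> \int[mu]_(t in A) H t = 0.
Proof.
move=> iH mG GI HT HG.
have sGm := smallest_sub (@sigma_algebra_measurable _ T) mG.
have iHS A : <<s G >> A -> mu.-integrable A (EFin \o H).
  by move=> /sGm mA; exact: integrableS iH.
apply: (@dynkin_induction _ (g_sigma_algebraType G) G
  (fun A => \int[mu]_(t in A) H t = 0)) => //.
- move=> A mA HA; have := HT.
  rewrite -(setUv A) Rintegral_setU ?HA ?add0r//.
  + exact: sGm.
  + by apply: measurableC; exact: sGm.
  + by rewrite setUv.
  + by apply/disj_setPS; rewrite setICr.
- move=> F mF tF HF; rewrite /Rintegral integral_bigcup//.
  + rewrite eseries0// => i _ _; rewrite -[LHS]fineK.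
      by congr EFin; exact: HF.
    by apply: integrable_fin_num; [exact: sGm (mF i)|exact: iHS (mF i)].
  + by move=> k; exact: sGm (mF k).
  + apply: iHS; exact: (@bigcupT_measurable _ (g_sigma_algebraType G)).
Qed.

(* Layer cake: [f (X t)] is the mean over [r] of the indicator of [r < f (X t)]. *)
Let Rintegral0_comp01 (P : probability T R) d' (S : measurableType d')
    (H : T -> R) (X : T -> S) (f : S -> R) :
  bounded_measurable H -> measurable_fun setT X ->
  measurable_fun setT f -> (forall x, 0 <= f x <= 1) ->
  (forall C, measurable C -> \int[P]_(t in X @^-1` C) H t = 0) ->
  \int[P]_t (H t * f (X t)) = 0.
Proof.
move=> bH mX mf f01 HX; pose Q := uniform_prob (@ltr01 R).
pose k (z : T * R) : R := if z.2 < f (X z.1) then 1 else 0.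
have k_section1 t r : k (t, r) = \1_(`]-oo, f (X t)[) r.
  by rewrite /k indicE mem_setE in_itv/=; case: ifP.
have k_section2 t r : k (t, r) = \1_(X @^-1` [set x | r < f x]) t.
  rewrite /k indicE (_ : (t \in _) = (r < f (X t))); first by case: ifP.
  by apply/idP/idP; rewrite inE.
have bk : bounded_measurable k.
  split; last by exists 1 => -[t r]; rewrite k_section1 normr_indic_le1.
  apply: measurable_fun_ifT => //; apply: measurable_fun_ltr => //.
  by apply: (measurableT_comp mf); exact: measurableT_comp mX measurable_fst.
have k_mean t : \int[Q]_r k (t, r) = f (X t).
  under eq_Rintegral do rewrite k_section1.
  rewrite /Rintegral integral_indic// setIT.
  by rewrite [X in fine X]uniform_prob_itvNyo//= !subr0 divr1.
have bHk : bounded_measurable (fun z => H z.1 * k z).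
  exact: bounded_measurableM (bounded_measurable_comp bH measurable_fst) bk.
transitivity (\int[P]_t \int[Q]_r (H t * k (t, r))).
  apply: eq_Rintegral => t _; rewrite -k_mean RintegralZl//.
  apply: bounded_measurable_integrable.
  exact: bounded_measurable_comp bk (pair1_measurable t).
rewrite (Rintegral_fubini P Q bHk) -[RHS](Rintegral_probability_cst Q 0).
apply: eq_Rintegral => r _; rewrite -[RHS](HX [set x | r < f x]).
  by rewrite [RHS]Rintegral_mul_indic; apply: eq_Rintegral => t _; rewrite k_section2.
rewrite (_ : [set x | r < f x] = setT `&` f @^-1` `]r, +oo[); first exact: mf.
by rewrite setTI set_itvoy.
Qed.

Lemma Rintegral0_comp (P : probability T R) d' (S : measurableType d')
    (H : T -> R) (X : T -> S) (f : S -> R) :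
  bounded_measurable H -> measurable_fun setT X -> bounded_measurable f ->
  (forall C, measurable C -> \int[P]_(t in X @^-1` C) H t = 0) ->
  \int[P]_t (H t * f (X t)) = 0.
Proof.
move=> bH mX bf HX; have [mf [M fM]] := bf; pose c := `|M| + 1.
have c0 : 0 < c by rewrite ltr_wpDl.
pose f01 x := (c + c)^-1 * (f x + c).
have f01_bound x : 0 <= f01 x <= 1.
  have : `|f x| <= c by rewrite (le_trans (fM x))// (le_trans (ler_norm M))// lerDl.
  rewrite ler_norml => /andP[Nc_le f_le].
  have cc0 : 0 < c + c by rewrite addr_gt0.
  rewrite /f01 mulrC (ler_pdivlMr _ _ cc0) (ler_pdivrMr _ _ cc0) mul0r mul1r lerD2r f_le.
  by rewrite -lerBlDr sub0r Nc_le.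
have bf01 : bounded_measurable f01.
  by apply/bounded_measurableZ/bounded_measurableD => //; exact: bounded_measurable_cst.
have bHf01 := bounded_measurableM bH (bounded_measurable_comp bf01 mX).
have HT : \int[P]_t H t = 0 by rewrite -[RHS](HX setT).
transitivity (\int[P]_t ((c + c) * (H t * f01 (X t)) - c * H t)).
  by apply: eq_Rintegral => t _; rewrite /f01; field; rewrite gt_eqF// addr_gt0.
rewrite bounded_RintegralB; [|exact: bounded_measurableZ|exact: bounded_measurableZ].
by rewrite !bounded_RintegralZ// HT (Rintegral0_comp01 bH mX bf01.1)// !mulr0 subrr.
Qed.

End vanishing_integrals.

Section fourier_uniqueness.
Context {R : realType}.
Implicit Types a b e x v : R.

Lemma mul_cos x y : cos x * cos y = 2^-1 * (cos (x + y) + cos (x - y)) :> R.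
Proof. by rewrite cosD cosB; field. Qed.

Lemma normal_pdf_cos a e v : e != 0 ->
  normal_pdf a e v =
  \int[normal_prob 0 e^-1]_s (normal_peak e * cos (s * a + - (s * v))).
Proof.
move=> e0; rewrite normal_pdf_expR//.
have eE s : cos (s * a + - (s * v)) = cos ((a - v) * s + 0) by congr cos; ring.
under eq_Rintegral do rewrite eE.
rewrite bounded_RintegralZ; last exact: bounded_measurable_cos (measurable_affine _ _).
rewrite normal_prob_cos ?invr_eq0// cos0 mulr1.
by congr (_ * expR _); field.
Qed.

Lemma uniform_normal_pdf x e a b (ab : a < b) : 0 < e ->
  \int[uniform_prob ab]_v ((b - a) * normal_pdf x e v) =
  std_Phi ((b - x) / e) - std_Phi ((a - x) / e).
Proof.
move=> e0; have ba0 : 0 < b - a by rewrite subr_gt0.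
rewrite /Rintegral integral_uniform; last 2 first.
- by apply/measurable_EFinP/measurable_funM => //; exact: measurable_normal_pdf.
- by move=> v; rewrite lee_fin mulr_ge0 ?normal_pdf_ge0// ltW.
under eq_integral do rewrite EFinM.
rewrite ge0_integralZl//; last 3 first.
- by apply: measurable_funTS; exact: measurable_EFin_normal_pdf.
- by move=> v _; rewrite lee_fin normal_pdf_ge0.
- by rewrite lee_fin ltW.
rewrite muleA -EFinM mulVf ?gt_eqF// mul1e -integral_itv_obnd_cbnd; last first.
  by apply: measurable_funTS; exact: measurable_EFin_normal_pdf.
by rewrite [X in fine X](normal_prob_itvoc _ e0 (ltW ab)).
Qed.

(* Shifting [b] by more than the standard deviation makes the limit at [x = b] the
   value [1] of the indicator. *)
Lemma cvg_std_Phi_indic b x :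
  std_Phi ((b + n.+1%:R^-1 - x) / n.+1%:R ^- 2) @[n --> \oo] --> (\1_(`]-oo, b]) x : R).
Proof.
have argE n : (b + n.+1%:R^-1 - x) / n.+1%:R ^- 2 = n.+1%:R * ((b - x) * n.+1%:R + 1) :> R.
  have : n.+1%:R != 0 :> R by rewrite pnatr_eq0.
  by move: (n.+1%:R : R) => m m0; field.
have cvg_natr : (n.+1%:R : R) @[n --> \oo] --> +oo.
  by apply/cvgryPge => A; near=> n; rewrite (@le_trans _ _ n%:R) ?ler_nat//;
    near: n; exact: nbhs_infty_ger.
under eq_fun do rewrite argE.
rewrite indicE mem_setE in_itv/=; have [xb|bx] := leP x b.
  apply: (cvg_comp (fun n => n.+1%:R * ((b - x) * n.+1%:R + 1)) _ _ cvg_std_Phiy).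
  move/cvgryPge: cvg_natr => n_ge; apply/cvgryPge => A; apply: filterS (n_ge A) => n An.
  by rewrite (le_trans An)// ler_peMr// lerDr mulr_ge0// subr_ge0.
apply: (cvg_comp (fun n => n.+1%:R * ((b - x) * n.+1%:R + 1)) _ _ cvg_std_PhiNy).
move/cvgryPge: cvg_natr => n_ge; apply/cvgrNyPle => A.
have xb0 : 0 < x - b by rewrite subr_gt0.
apply: filterS2 (n_ge (2 / (x - b))) (n_ge (- A)) => n.
rewrite ler_pdivrMr// => n_large An.
have : 0 <= n.+1%:R :> R by [].
by move: (n.+1%:R : R) n_large An => m; nra.
Unshelve. all: by end_near. Qed.

Section one_variable.
Context d (T : measurableType d) (P : probability T R) (H X : T -> R).
Hypotheses (bH : bounded_measurable H) (mX : measurable_fun setT X).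
Hypothesis H_cos : forall s th, \int[P]_t (H t * cos (s * X t + th)) = 0.

Let mXz : measurable_fun setT (fun z : T * R => X z.1).
Proof. exact: measurableT_comp mX measurable_fst. Qed.

Let integral_H : \int[P]_t H t = 0.
Proof.
by rewrite -[RHS](H_cos 0 0); apply: eq_Rintegral => t _; rewrite mul0r addr0 cos0 mulr1.
Qed.

Let H_normal_pdf e v : e != 0 -> \int[P]_t (H t * normal_pdf (X t) e v) = 0.
Proof.
move=> e0; pose Q := normal_prob 0 e^-1; pose p := normal_peak e.
pose h (z : T * R) := H z.1 * (p * cos (z.2 * X z.1 + - (z.2 * v))).
have bcos : bounded_measurable (fun z : T * R => p * cos (z.2 * X z.1 + - (z.2 * v))).
  apply/bounded_measurableZ/bounded_measurable_cos.
  apply: measurable_funD; first exact: measurable_funM.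
  by apply: measurableT_comp => //; exact: measurable_funM.
have bh : bounded_measurable h.
  exact: bounded_measurableM (bounded_measurable_comp bH measurable_fst) bcos.
transitivity (\int[P]_t \int[Q]_s h (t, s)).
  apply: eq_Rintegral => t _; rewrite normal_pdf_cos// -bounded_RintegralZ//.
  exact: bounded_measurable_comp bcos (pair1_measurable t).
rewrite (Rintegral_fubini P Q bh) -[RHS](Rintegral_probability_cst Q 0).
apply: eq_Rintegral => s _; rewrite /h/=.
under eq_Rintegral do rewrite mulrCA.
rewrite bounded_RintegralZ ?H_cos ?mulr0//.
apply/(bounded_measurableM bH)/bounded_measurable_cos.
by apply: measurable_funD => //; exact: measurable_funM.
Qed.

Let H_std_Phi e a b : 0 < e -> a < b ->
  \int[P]_t (H t * (std_Phi ((b - X t) / e) - std_Phi ((a - X t) / e))) = 0.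
Proof.
move=> e0 ab; have eN0 : e != 0 by rewrite gt_eqF.
pose Q := uniform_prob ab.
have bpdf : bounded_measurable (fun z : T * R => normal_pdf (X z.1) e z.2).
  split.
    exact: measurableT_comp (measurable_normal_pdf_pair eN0)
      (measurable_fun_pair mXz measurable_snd).
  by exists (normal_peak e) => z; rewrite ger0_norm ?normal_pdf_ge0// normal_pdf_ub.
have bZpdf := bounded_measurableZ (b - a) bpdf.
pose h (z : T * R) := H z.1 * ((b - a) * normal_pdf (X z.1) e z.2).
have bh : bounded_measurable h.
  exact: bounded_measurableM (bounded_measurable_comp bH measurable_fst) bZpdf.
transitivity (\int[P]_t \int[Q]_v h (t, v)).
  apply: eq_Rintegral => t _; rewrite -(uniform_normal_pdf _ ab e0) -bounded_RintegralZ//.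
  exact: bounded_measurable_comp bZpdf (pair1_measurable t).
rewrite (Rintegral_fubini P Q bh) -[RHS](Rintegral_probability_cst Q 0).
apply: eq_Rintegral => v _; rewrite /h/=.
under eq_Rintegral do rewrite mulrCA.
rewrite bounded_RintegralZ ?H_normal_pdf ?mulr0//.
exact: bounded_measurableM bH (bounded_measurable_comp bpdf (pair2_measurable v)).
Qed.

Let H_itvoc a b : a < b -> \int[P]_(t in X @^-1` `]a, b]) H t = 0.
Proof.
move=> ab; have [mH [M HM]] := bH.
pose Phi_ c n t := std_Phi ((c + n.+1%:R^-1 - X t) / n.+1%:R ^- 2).
have mPhi_ c n : measurable_fun setT (Phi_ c n).
  apply: measurableT_comp; first exact: measurable_std_Phi.
  by apply: measurable_funM => //; exact: measurable_funB.
have Phi_le1 n t : `|Phi_ b n t - Phi_ a n t| <= 1.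
  have Phi_01 c : 0 <= Phi_ c n t <= 1 by rewrite std_Phi_ge0 std_Phi_le1.
  by move: (Phi_01 a) (Phi_01 b); rewrite ler_norml; lra.
transitivity (\int[P]_t (H t * (\1_(`]-oo, b]) (X t) - \1_(`]-oo, a]) (X t)))).
  rewrite Rintegral_mul_indic; apply: eq_Rintegral => t _; congr (_ * _).
  rewrite -[LHS]/(\1_(`]a, b]) (X t)) !indicE !mem_setE !in_itv/=.
  have [Xa|aX] := leP (X t) a; last by rewrite subr0.
  by rewrite (le_trans Xa (ltW ab)) subrr.
have : \int[P]_t (H t * (Phi_ b n t - Phi_ a n t)) @[n --> \oo] -->
    \int[P]_t (H t * (\1_(`]-oo, b]) (X t) - \1_(`]-oo, a]) (X t))).
  apply: (@bounded_convergence _ _ _ P M).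
  - by move=> n; apply: measurable_funM => //; exact: measurable_funB.
  - by move=> n t; rewrite normrM -[leRHS]mulr1 ler_pM.
  - by move=> t; apply: cvgMr; apply: cvgB; exact: cvg_std_Phi_indic.
under eq_fun do rewrite H_std_Phi ?invr_gt0 ?exprn_gt0 ?ltrD2r//.
by move=> /(cvg_unique _); apply => //; exact: cvg_cst.
Qed.

Theorem fourier_uniqueness (C : set R) : measurable C ->
  \int[P]_(t in X @^-1` C) H t = 0.
Proof.
move=> mC; have sC : <<s preimage_set_system setT X (@ocitv R) >> (X @^-1` C).
  by rewrite g_sigma_preimageE; exists C => //; rewrite setTI.
apply: (Rintegral0_g_sigma _ _ _ integral_H _ sC).
- exact: bounded_measurable_integrable.
- by move=> _ [_ [[a b] _ <-] <-]; exact: mX.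
- move=> _ _ [A ocA <-] [B ocB <-]; exists (A `&` B); first exact: ocitvI.
  by rewrite !setTI.
- move=> _ [_ /ocitvP[->|[[a b] /= ab ->]] <-]; rewrite setTI.
    by rewrite preimage_set0 Rintegral_set0.
  exact: H_itvoc.
Qed.

End one_variable.

Section several_variables.
Context d (T : measurableType d) (P : probability T R).

Lemma fourier_uniqueness_phase (H L X : T -> R) (C : set R) (th : R) :
  bounded_measurable H -> measurable_fun setT L -> measurable_fun setT X -> measurable C ->
  (forall s th', \int[P]_t (H t * cos (L t + s * X t + th')) = 0) ->
  \int[P]_(t in X @^-1` C) (H t * cos (L t + th)) = 0.
Proof.
move=> bH mL mX mC H_cos.
have bHcos s th' : bounded_measurable (fun t => H t * cos (L t + s * X t + th')).
  apply/(bounded_measurableM bH)/bounded_measurable_cos.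
  by apply: measurable_funD => //; apply: measurable_funD => //; exact: measurable_funM.
apply: fourier_uniqueness => //.
  by apply/(bounded_measurableM bH)/bounded_measurable_cos; exact: measurable_funD.
move=> s th'; transitivity (\int[P]_t (
    2^-1 * (H t * cos (L t + s * X t + (th + th'))) +
    2^-1 * (H t * cos (L t + - s * X t + (th - th'))))).
  apply: eq_Rintegral => t _; rewrite -mulrA mul_cos -mulrDr mulrCA -mulrDr.
  by congr (_ * (_ * (cos _ + cos _))); ring.
rewrite bounded_RintegralD; [|exact: bounded_measurableZ|exact: bounded_measurableZ].
by rewrite !bounded_RintegralZ// !H_cos mulr0 addr0.
Qed.

Lemma fourier_uniqueness_seq (I : eqType) (r : seq I) (X : I -> T -> R) (H : T -> R)
    (C : I -> set R) :
  uniq r -> (forall i, measurable_fun setT (X i)) -> (forall i, measurable (C i)) ->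
  bounded_measurable H ->
  (forall (al : I -> R) th, \int[P]_t (H t * cos (\sum_(i <- r) al i * X i t + th)) = 0) ->
  \int[P]_t (H t * \prod_(i <- r) \1_(C i) (X i t)) = 0.
Proof.
move=> + mX mC; elim: r => [|j r IH] in H * => /=.
  move=> _ bH H_cos; rewrite -[RHS](H_cos (fun=> 0) 0).
  by apply: eq_Rintegral => t _; rewrite !big_nil addr0 cos0.
move=> /andP[jr ur] bH H_cos.
transitivity (\int[P]_t ((H t * \1_(C j) (X j t)) * \prod_(i <- r) \1_(C i) (X i t))).
  by apply: eq_Rintegral => t _; rewrite big_cons mulrA.
apply: IH => //.
  apply: bounded_measurableM => //.
  exact: bounded_measurable_comp (bounded_measurable_indic _ (mC j)) (mX j).
move=> al th; transitivity (\int[P]_(t in X j @^-1` C j)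
    (H t * cos (\sum_(i <- r) al i * X i t + th))).
  by rewrite [RHS]Rintegral_mul_indic; apply: eq_Rintegral => t _; rewrite mulrAC.
apply: fourier_uniqueness_phase => //.
  by apply: measurable_sum => i; exact: measurable_funM.
move=> s th'; rewrite -[RHS](H_cos (fun i => if i == j then s else al i) th').
apply: eq_Rintegral => t _; rewrite big_cons eqxx.
congr (_ * cos (_ + _)); rewrite addrC; congr (_ + _).
by apply: eq_big_seq => i ir; case: eqP => // ij; rewrite -ij ir in jr.
Qed.

Theorem fourier_uniqueness_fin (I : finType) (X : I -> T -> R) (H : T -> R)
    (C : I -> set R) :
  (forall i, measurable_fun setT (X i)) -> (forall i, measurable (C i)) ->
  bounded_measurable H ->
  (forall (al : I -> R) th, \int[P]_t (H t * cos (\sum_i al i * X i t + th)) = 0) ->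
  \int[P]_(t in [set t | forall i, C i (X i t)]) H t = 0.
Proof.
move=> mX mC bH H_cos.
rewrite -[RHS](fourier_uniqueness_seq (index_enum_uniq I) mX mC bH H_cos).
rewrite Rintegral_mul_indic; apply: eq_Rintegral => t _; congr (_ * _).
have [Ct|/existsNP[i nCi]] := pselect (forall i, C i (X i t)).
  by rewrite indicE mem_set// big1// => i _; rewrite indicE mem_set.
rewrite (bigD1 i)//= !indicE !memNset ?mul0r// => Ct; exact: nCi.
Qed.

End several_variables.
End fourier_uniqueness.

Section independence.
Context d (T : measurableType d) (R : realType) (P : probability T R).

Definition independent d1 d2 (T1 : measurableType d1) (T2 : measurableType d2)
    (U : T -> T1) (X : T -> T2) : Prop :=
  forall A B, measurable A -> measurable B ->
    P (U @^-1` A `&` X @^-1` B) = (P (U @^-1` A) * P (X @^-1` B))%E.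

Lemma Rintegral_indic_sub (A D : set T) (f : T -> R) : measurable A -> measurable D ->
  bounded_measurable f ->
  \int[P]_(t in D) (\1_A t - f t) = fine (P (A `&` D)) - \int[P]_(t in D) f t.
Proof.
move=> mA mD bf; rewrite RintegralB//.
- by rewrite [X in X - _]/Rintegral integral_indic.
- apply: (integrableS measurableT) => //.
  exact: bounded_measurable_integrable (bounded_measurable_indic R mA).
- by apply: (integrableS measurableT) => //; exact: bounded_measurable_integrable.
Qed.

Lemma measure_setI_Rintegral (A D : set T) (f : T -> R) : measurable A -> measurable D ->
  bounded_measurable f -> \int[P]_(t in D) (\1_A t - f t) = 0 ->
  P (A `&` D) = (\int[P]_(t in D) (f t)%:E)%E.
Proof.
move=> mA mD bf; rewrite Rintegral_indic_sub// => /eqP; rewrite subr_eq0 => /eqP PE.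
have ifD : P.-integrable D (EFin \o f).
  by apply: (integrableS measurableT) => //; exact: bounded_measurable_integrable.
by rewrite -[LHS]fineK ?fin_num_measure ?PE ?fineK ?integrable_fin_num//; exact: measurableI.
Qed.

Lemma independent_g_sigma (A : set T) (G : set (set T)) : measurable A ->
  G `<=` measurable -> setI_closed G ->
  (forall D, G D -> P (A `&` D) = (P A * P D)%E) ->
  forall D, <<s G >> D -> P (A `&` D) = (P A * P D)%E.
Proof.
move=> mA mG GI indepG D sD.
have mD : measurable D := smallest_sub (@sigma_algebra_measurable _ T) mG sD.
have fineE E : measurable E -> (P (A `&` E) = P A * P E)%E <->
    \int[P]_(t in E) (\1_A t - fine (P A)) = 0.
  move=> mE; rewrite (Rintegral_indic_sub mA mE (bounded_measurable_cst _ _)).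
  rewrite Rintegral_cst// -fineM ?fin_num_measure//.
  split=> [->|/eqP]; first by rewrite subrr.
  rewrite subr_eq0 => /eqP /(congr1 (@EFin R)).
  by rewrite !fineK ?fin_numM ?fin_num_measure//; exact: measurableI.
apply/fineE => //; apply: Rintegral0_g_sigma sD => //.
- apply/bounded_measurable_integrable/bounded_measurableB; last exact: bounded_measurable_cst.
  exact: bounded_measurable_indic.
- by apply/fineE => //; rewrite setIT probability_setT mule1.
- by move=> E GE; apply/fineE; [exact: mG|exact: indepG].
Qed.

Section joint_law.
Context d1 d2 (T1 : measurableType d1) (T2 : measurableType d2).
Variables (U : T -> T1) (X : T -> T2).
Hypotheses (mU : measurable_fun setT U) (mX : measurable_fun setT X).
Hypothesis indep_UX : independent U X.

Let rvU : {RV P >-> T1} := mfun_Sub (mem_set mU).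
Let rvX : {RV P >-> T2} := mfun_Sub (mem_set mX).
Let rvUX : {RV P >-> (T1 * T2)%type} := mfun_Sub (mem_set (measurable_fun_pair mU mX)).

Let distribution_pair (A : set (T1 * T2)) : measurable A ->
  distribution P rvUX A = (distribution P rvU \x distribution P rvX)%E A.
Proof.
by move=> mA; apply/esym/product_measure_unique => // B C mB mC; exact: indep_UX.
Qed.

Lemma ge0_integral_independent (g : T1 * T2 -> \bar R) : measurable_fun setT g ->
  (forall z, 0 <= g z)%E ->
  (\int[P]_t g (U t, X t) = \int[P]_t \int[P]_t' g (U t, X t'))%E.
Proof.
move=> mg g0.
rewrite -(ge0_integral_distribution rvUX)//.
rewrite (eq_measure_integral (distribution P rvU \x distribution P rvX)%E); last first.
  by move=> A mA _; exact: distribution_pair.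
rewrite fubini_tonelli1// ge0_integral_distribution//; last 2 first.
- exact: measurable_fun_fubini_tonelli_F.
- by move=> u; exact: integral_ge0.
apply: eq_integral => t _.
apply: (ge0_integral_distribution rvX (f := fun x => g (U t, x))) => //.
exact: measurableT_comp mg (pair1_measurable _).
Qed.

Lemma Rintegral_independent (g : T1 * T2 -> R) : bounded_measurable g ->
  \int[P]_t g (U t, X t) = \int[P]_t \int[P]_t' g (U t, X t').
Proof.
move=> bg; rewrite (Rintegral_distribution rvUX bg).
transitivity (\int[(distribution P rvU \x distribution P rvX)%E]_z g z).
  by congr fine; apply: eq_measure_integral => A mA _; exact: distribution_pair.
rewrite Rintegral_prod1//.
rewrite -(Rintegral_distribution rvU (bounded_measurable_Rintegral (distribution P rvU) _ bg)).
apply: eq_Rintegral => t _; rewrite -(Rintegral_distribution rvX)//.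
exact: bounded_measurable_comp bg (pair1_measurable _).
Qed.

End joint_law.

End independence.

Section truncated_normal.
Context {R : realType}.
Notation mu := (@lebesgue_measure R).
Implicit Types (a s u : R) (B : set R).

Lemma tn_pdfE a s u : 0 < s ->
  tn_pdf a (s ^+ 2) u = \1_(`]0, +oo[) u * (normal_pdf a s u / std_Phi (a / s)).
Proof.
move=> s0; rewrite /tn_pdf sqrtr_sqr gtr0_norm// indicE mem_setE in_itv/= andbT.
by case: ifP; rewrite ?mul1r ?mul0r.
Qed.

Lemma tn_pdf_ge0 a s u : 0 < s -> 0 <= tn_pdf a (s ^+ 2) u.
Proof.
by move=> s0; rewrite tn_pdfE// !mulr_ge0 ?normal_pdf_ge0// invr_ge0 std_Phi_ge0.
Qed.

Lemma measurable_tn_pdf a s : 0 < s -> measurable_fun setT (tn_pdf a (s ^+ 2)).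
Proof.
move=> s0; rewrite (_ : tn_pdf _ _ = fun u =>
    \1_(`]0, +oo[) u * (normal_pdf a s u / std_Phi (a / s))); last first.
  by apply/funext => u; rewrite tn_pdfE.
apply: measurable_funM; first exact: measurable_indic.
by apply: measurable_funM => //; exact: measurable_normal_pdf.
Qed.

Lemma tn_probE a s B : 0 < s -> measurable B -> tn_prob a (s ^+ 2) B =
  ((std_Phi (a / s))^-1%:E * normal_prob a s (B `&` `]0%R, +oo[))%E.
Proof.
move=> s0 mB; rewrite /normal_prob -ge0_integralZl//.
- rewrite [RHS]integral_mkcondr; apply: eq_integral => u _.
  rewrite epatch_indic tn_pdfE// -!EFinM; congr EFin; ring.
- exact: measurableI.
- by apply: measurable_funTS; exact: measurable_EFin_normal_pdf.
- by move=> u _; rewrite lee_fin normal_pdf_ge0.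
- by rewrite lee_fin invr_ge0 std_Phi_ge0.
Qed.

Lemma tn_prob_setT a s : 0 < s -> tn_prob a (s ^+ 2) setT = 1%E.
Proof.
move=> s0; rewrite tn_probE// setTI normal_prob_itv0y// -EFinM mulVf//.
by rewrite gt_eqF// std_Phi_gt0.
Qed.

Lemma fine_tn_prob_ge0 a s B : 0 < s -> measurable B -> 0 <= fine (tn_prob a (s ^+ 2) B).
Proof.
by move=> s0 mB; rewrite tn_probE// fine_ge0// mule_ge0// lee_fin invr_ge0 std_Phi_ge0.
Qed.

Lemma tn_prob_fin_num a s B : 0 < s -> measurable B -> tn_prob a (s ^+ 2) B \is a fin_num.
Proof.
by move=> s0 mB; rewrite tn_probE// fin_numM// fin_num_measure//; exact: measurableI.
Qed.

Lemma tn_prob_le1 a s B : 0 < s -> measurable B -> (tn_prob a (s ^+ 2) B <= 1)%E.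
Proof.
move=> s0 mB; rewrite -(tn_prob_setT a s0) !tn_probE// setTI.
rewrite lee_wpmul2l ?lee_fin ?invr_ge0 ?std_Phi_ge0// le_measure ?inE//.
exact: measurableI.
Qed.

Lemma bounded_measurable_tn_prob s B : 0 < s -> measurable B ->
  bounded_measurable (fun a => fine (tn_prob a (s ^+ 2) B)).
Proof.
move=> s0 mB; split; last first.
  exists 1 => a; rewrite ger0_norm ?fine_tn_prob_ge0//.
  by rewrite -lee_fin fineK ?tn_prob_le1 ?tn_prob_fin_num.
have mBy : measurable (B `&` `]0, +oo[) by exact: measurableI.
have tnE a : fine (tn_prob a (s ^+ 2) B) =
    (std_Phi (a / s))^-1 * fine (normal_prob a s (B `&` `]0, +oo[)).
  by rewrite tn_probE// fineM// fin_num_measure.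
under eq_fun do rewrite tnE.
apply: measurable_funM.
  by apply: (measurableT_comp measurable_inv_std_Phi); exact: measurable_funM.
by apply: measurableT_comp => //; apply: measurable_normal_prob; rewrite // gt_eqF.
Qed.

End truncated_normal.

Section truncated_normal_moments.
Context {R : realType}.
Notation mu := (@lebesgue_measure R).
Variables (a s : R).
Hypothesis s0 : 0 < s.
Local Notation q := (normal_pdf a s).

Let sN0 : s != 0. Proof. by rewrite gt_eqF. Qed.

Let half_moment k := \int[mu]_(u in `[0, +oo[) (u ^+ k * q u).

Let integrable_half k : mu.-integrable `[0, +oo[ (EFin \o (fun u : R => u ^+ k * q u)).
Proof. by apply: (integrableS measurableT) => //; exact: integrable_exp_normal. Qed.

Let is_derive_exp_normal k (u : R) : is_derive u 1 (fun u => - s ^+ 2 * (u ^+ k * q u))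
  (u ^+ k.+1 * q u - a * (u ^+ k * q u) - s ^+ 2 * k%:R * (u ^+ k.-1 * q u)).
Proof.
have dq := is_derive_normal_pdf a u sN0.
have dX : is_derive u 1 (fun u : R => u ^+ k) (k%:R * u ^+ k.-1).
  have -> : (fun u : R => u ^+ k) = (@id R) ^+ k by apply/funext => v; rewrite exprfctE.
  by apply: is_derive_eq; rewrite /GRing.scale/= mulr1.
apply: is_derive_eq; rewrite (exprS u k) /GRing.scale/=.
by move: (u ^+ k) (u ^+ k.-1) => x y; field.
Qed.

(* Integration by parts, the Gaussian density being an antiderivative of
   [- (u - a) / s ^+ 2 * q u]. *)
Let half_moment_rec k : half_moment k.+1 =
  a * half_moment k + s ^+ 2 * (k%:R * half_moment k.-1) + s ^+ 2 * (0 ^+ k * q 0).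
Proof.
have mhalf : measurable (`[0, +oo[%classic : set (measurableTypeR R)) by exact: measurable_itv.
have i1 := integrableZl mhalf a (integrable_half k).
have i2 := integrableZl mhalf (s ^+ 2 * k%:R) (integrable_half k.-1).
have i01 := integrableB mhalf (integrable_half k.+1) i1.
have cX j : continuous (fun u : R => u ^+ j * q u).
  move=> u; apply: cvgM; first exact: exprn_continuous.
  exact: continuous_normal_pdf.
have : \int[mu]_(u in `[0, +oo[) (u ^+ k.+1 * q u - a * (u ^+ k * q u) -
    s ^+ 2 * k%:R * (u ^+ k.-1 * q u)) = 0 - - s ^+ 2 * (0 ^+ k * q 0).
  apply: (Rintegral_itvcy_derive _ _ (is_derive_exp_normal k)).
  - move=> u; apply: cvgB; first apply: cvgB; first exact: cX.
      by apply: cvgMr; exact: cX.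
    by apply: cvgMr; exact: cX.
  - exact: (integrableB mhalf i01 i2).
  - rewrite -[X in _ --> X](mulr0 (- s ^+ 2)); apply: cvgMr.
    exact: cvg_exp_normal_pdfy.
rewrite (RintegralB _ i01 i2)// (RintegralB _ (integrable_half k.+1) i1)//.
rewrite !(RintegralZl _ _ (integrable_half _))//.
rewrite -/(half_moment k.+1) -/(half_moment k) -/(half_moment k.-1) => /eqP.
by rewrite sub0r mulNr opprK !subr_eq => /eqP ->; ring.
Qed.

Let tn_moment_half k : tn_moment a (s ^+ 2) k = (half_moment k / std_Phi (a / s))%:E.
Proof.
have iX := integrable_exp_normal a k sN0.
transitivity ((std_Phi (a / s))^-1%:E * \int[mu]_(u in `]0%R, +oo[) (u ^+ k * q u)%:E)%E.
  rewrite -integralZl//; last by apply: (integrableS measurableT).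
  rewrite [RHS]integral_indic_mul; apply: eq_integral => u _.
  by rewrite tn_pdfE// -!EFinM; congr EFin; ring.
rewrite integral_itv_obnd_cbnd; last first.
  by apply: measurable_funTS; exact: measurable_int iX.
rewrite (mulrC (half_moment k)) EFinM; congr (_ * _)%E.
by rewrite /half_moment /Rintegral fineK//; exact: (integrable_fin_num _ (integrable_half k)).
Qed.

Let half_moment0 : half_moment 0 = std_Phi (a / s).
Proof.
rewrite /half_moment /Rintegral -[RHS]/(fine (std_Phi (a / s))%:E) -normal_prob_itv0y//.
congr fine; rewrite /normal_prob integral_itv_obnd_cbnd; last first.
  by apply: measurable_funTS; exact: measurable_EFin_normal_pdf.
by apply: eq_integral => u _; rewrite expr0 mul1r.
Qed.

Lemma tn_moment1 : tn_moment a (s ^+ 2) 1 =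
  (a + s * (std_phi (a / s) / std_Phi (a / s)))%:E.
Proof.
rewrite tn_moment_half half_moment_rec mul0r mulr0 addr0 half_moment0 expr0 mul1r.
have -> : std_phi (a / s) = s * q 0.
  rewrite /std_phi -[a / s]opprK normal_pdfN ?oner_neq0// oppr0.
  rewrite -(normal_pdf_affine 0 a _ s0 (oner_neq0 R)) mulr0 add0r mulr1.
  by congr (_ * normal_pdf _ _ _); field.
have := std_Phi_gt0 (a / s); move: (std_Phi _) => Phi Phi0.
by congr EFin; field; rewrite gt_eqF.
Qed.

Lemma tn_moment_rec k : tn_moment a (s ^+ 2) k.+2 =
  (a%:E * tn_moment a (s ^+ 2) k.+1 + (k.+1%:R * s ^+ 2)%:E * tn_moment a (s ^+ 2) k)%E.
Proof.
rewrite !tn_moment_half -!EFinM -EFinD half_moment_rec expr0n mul0r mulr0 addr0/=.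
by congr EFin; ring.
Qed.

End truncated_normal_moments.

Section posterior_law.
Context d (T : measurableType d) (R : realType) (P : probability T R).
Notation mu := (@lebesgue_measure R).
Variables (U S : T -> R) (w : R * R -> R).
Hypotheses (mU : measurable_fun setT U) (mS : measurable_fun setT S).
Hypotheses (mw : measurable_fun setT w) (w0 : forall z, 0 <= w z).
Hypothesis joint_density : forall G : R * R -> \bar R,
  measurable_fun setT G -> (forall z, 0 <= G z)%E ->
  (\int[P]_t G (U t, S t) = \int[mu]_v \int[mu]_u (G (u, v) * (w (u, v))%:E))%E.

Let mw2 v : measurable_fun [set: R] (fun u => (w (u, v))%:E).
Proof. by apply/measurable_EFinP; exact: measurableT_comp mw (pair2_measurable v). Qed.

Let integral_joint_preimage (g : R * R -> R) (C : set R) : measurable C ->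
  measurable_fun setT g -> (forall z, 0 <= g z) ->
  (\int[P]_(t in S @^-1` C) (g (U t, S t))%:E =
   \int[mu]_v ((\1_C v)%:E * \int[mu]_u ((g (u, v))%:E * (w (u, v))%:E)))%E.
Proof.
move=> mC mg g0; have mgE : measurable_fun setT (EFin \o g) by exact/measurable_EFinP.
rewrite integral_indic_mul.
rewrite (joint_density (G := fun z => (\1_C z.2)%:E * (g z)%:E)%E); last 2 first.
- apply: emeasurable_funM => //.
  by apply/measurable_EFinP; exact: measurableT_comp (measurable_indic mC) measurable_snd.
- by move=> z; rewrite mule_ge0 ?lee_fin.
apply: eq_integral => v _ /=; rewrite -ge0_integralZl//.
- by apply: eq_integral => u _; rewrite muleA.
- exact: emeasurable_funM (measurableT_comp mgE (pair2_measurable v)) (mw2 v).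
- by move=> u _; rewrite mule_ge0 ?lee_fin.
Qed.

Lemma bayes (B : set R) (k : R -> R) : measurable B -> bounded_measurable k ->
  (forall v, 0 <= k v) ->
  (forall v, \int[mu]_(u in B) (w (u, v))%:E = (k v)%:E * \int[mu]_u (w (u, v))%:E)%E ->
  forall C, measurable C -> \int[P]_(t in S @^-1` C) (\1_B (U t) - k (S t)) = 0.
Proof.
move=> mB bk k0 wB C mC.
have mSC : measurable (S @^-1` C) by rewrite -[X in measurable X]setTI; exact: mS.
have b1 := bounded_measurable_indic R mB.
rewrite RintegralB//; last 2 first.
- apply: (integrableS measurableT) => //.
  exact: bounded_measurable_integrable (bounded_measurable_comp b1 mU).
- apply: (integrableS measurableT) => //.
  exact: bounded_measurable_integrable (bounded_measurable_comp bk mS).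
apply/eqP; rewrite subr_eq0; apply/eqP; congr fine.
rewrite (@integral_joint_preimage (fun z => \1_B z.1) _ mC
  (measurableT_comp b1.1 measurable_fst) (fun z => ler0n _ _)).
rewrite (@integral_joint_preimage (fun z => k z.2) _ mC
  (measurableT_comp bk.1 measurable_snd) (fun z => k0 z.2)).
apply: eq_integral => v _ /=; rewrite -integral_indic_mul wB -ge0_integralZl//.
- exact: mw2.
- by move=> u _; rewrite lee_fin.
- by rewrite lee_fin.
Qed.

End posterior_law.

Section law_with_density.
Context d (T : measurableType d) (R : realType) (P : probability T R).
Notation mu := (@lebesgue_measure R).

Lemma ge0_integral_law (X : T -> R) (q : R -> R) (f : R -> \bar R) :
  measurable_fun setT X -> measurable_fun setT q -> (forall x, 0 <= q x) ->
  (forall A, measurable A -> P (X @^-1` A) = (\int[mu]_(x in A) (q x)%:E)%E) ->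
  measurable_fun setT f -> (forall x, 0 <= f x)%E ->
  (\int[P]_t f (X t) = \int[mu]_x (f x * (q x)%:E))%E.
Proof.
move=> mX mq q0 lawX mf f0.
pose rvX : {RV P >-> measurableTypeR R} :=
  HB.pack X (isMeasurableFun.Build _ _ _ (measurableTypeR R) X mX).
rewrite -(@ge0_integral_density _ _ _ (distribution P rvX) mu q)//.
by rewrite ge0_integral_distribution.
Qed.

Lemma ge0_integral_normal_translate (X : T -> R) (c s : R) (f : R -> \bar R) :
  measurable_fun setT X -> s != 0 ->
  (forall A, measurable A -> P (X @^-1` A) = normal_prob 0 s A) ->
  measurable_fun setT f -> (forall x, 0 <= f x)%E ->
  (\int[P]_t f (c + X t)%R = \int[mu]_x (f x * (normal_pdf c s x)%:E))%E.
Proof.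
move=> mX s0 lawX mf f0.
have mfc : measurable_fun setT (fun x => f (c + x)).
  by apply: (measurableT_comp mf); exact: measurable_funD.
rewrite [LHS](@ge0_integral_law X _ (fun x => f (c + x)) mX (measurable_normal_pdf 0 s)
  (normal_pdf_ge0 0 s) lawX mfc (fun x => f0 _)).
have := ge0_integral_normal_affine 0 c (@ltr01 R) s0 mf f0.
rewrite mulr0 add0r mul1r => ->.
by apply: eq_integral => x _; rewrite mul1r addrC.
Qed.

Lemma ge0_integral_normal_shift (U X : T -> R) (e : R -> R) (c s : R)
    (G : R * R -> \bar R) :
  measurable_fun setT U -> measurable_fun setT X -> independent P U X ->
  measurable_fun setT e -> (forall u, 0 <= e u) ->
  (forall A, measurable A -> P (U @^-1` A) = (\int[mu]_(u in A) (e u)%:E)%E) ->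
  s != 0 -> (forall A, measurable A -> P (X @^-1` A) = normal_prob 0 s A) ->
  measurable_fun setT G -> (forall z, 0 <= G z)%E ->
  (\int[P]_t G (U t, (c * U t + X t)%R) =
   \int[mu]_v \int[mu]_u (G (u, v) * (normal_pdf (c * u) s v * e u)%:E))%E.
Proof.
move=> mU mX indep_UX me e0 lawU s0 lawX mG G0.
have mGu u : measurable_fun setT (fun v : R => G (u, v)).
  exact: measurableT_comp mG (pair1_measurable u).
have mpdf : measurable_fun setT (fun z : R * R => normal_pdf (c * z.1) s z.2).
  have mc1 : measurable_fun setT (fun z : R * R => c * z.1) by exact: measurable_funM.
  exact: measurableT_comp (measurable_normal_pdf_pair s0)
    (measurable_fun_pair mc1 measurable_snd).
pose g (z : R * R) := G (z.1, c * z.1 + z.2).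
have mg : measurable_fun setT g.
  apply: measurableT_comp => //; apply: measurable_fun_pair => //.
  by apply: measurable_funD => //; exact: measurable_funM.
rewrite [LHS](ge0_integral_independent mU mX indep_UX mg (fun z => G0 _)).
have translate u : (\int[P]_t g (u, X t) =
    \int[mu]_v (G (u, v) * (normal_pdf (c * u) s v)%:E))%E.
  exact: (@ge0_integral_normal_translate X (c * u) s (fun v => G (u, v)) mX s0 lawX
    (mGu u) (fun v => G0 _)).
under eq_integral do rewrite translate.
pose f (z : measurableTypeR R * measurableTypeR R) :=
  (G z * (normal_pdf (c * z.1) s z.2 * e z.1)%:E)%E.
have mf : measurable_fun setT f.
  apply: emeasurable_funM => //; apply/measurable_EFinP; apply: measurable_funM => //.
  exact: measurableT_comp me measurable_fst.
have f0 z : (0 <= f z)%E by rewrite mule_ge0// lee_fin mulr_ge0// normal_pdf_ge0.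
rewrite -(@fubini_tonelli _ _ _ _ _ mu mu f mf f0).
rewrite [LHS](@ge0_integral_law U _
  (fun u => \int[mu]_v (G (u, v) * (normal_pdf (c * u) s v)%:E))%E mU me e0 lawU).
- apply: eq_integral => u _; rewrite -ge0_integralZr.
  + by apply: eq_integral => v _; rewrite /f EFinM muleA.
  + by [].
  + exact: emeasurable_funM (mGu u) (measurable_EFin_normal_pdf _ _).
  + by move=> v _; rewrite mule_ge0// lee_fin normal_pdf_ge0.
  + by rewrite lee_fin.
- apply: (@measurable_fun_fubini_tonelli_F _ _ _ (measurableTypeR R) _ mu
    (fun z => (G z * (normal_pdf (c * z.1) s z.2)%:E)%E)).
    by apply: emeasurable_funM => //; exact/measurable_EFinP.
  by move=> z; rewrite mule_ge0// lee_fin normal_pdf_ge0.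
- by move=> u; apply: integral_ge0 => v _; rewrite mule_ge0// lee_fin normal_pdf_ge0.
Qed.

End law_with_density.

Section exponential_normal_posterior.
Context {R : realType}.
Notation mu := (@lebesgue_measure R).
Implicit Types (r eta u v : R).

Definition posterior_prob r eta (B : set R) v : R :=
  fine (tn_prob (eta^-1 * (eta^-1 * (v - r))) (eta^-1 ^+ 2) B).

Lemma bounded_measurable_posterior_prob r eta (B : set R) : 0 < eta -> measurable B ->
  bounded_measurable (posterior_prob r eta B).
Proof.
move=> eta0 mB; have etaV0 : 0 < eta^-1 by rewrite invr_gt0.
apply: bounded_measurable_comp (bounded_measurable_tn_prob etaV0 mB) _.
by apply: measurable_funM => //; apply: measurable_funM => //; exact: measurable_funB.
Qed.

Let open_exponential_pdf r u : R := \1_(`]0, +oo[) u * (r * expR (- r * u)).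

Let measurable_open_exponential_pdf r : measurable_fun setT (open_exponential_pdf r).
Proof.
apply: measurable_funM; first exact: measurable_indic.
by apply: measurable_funM => //; apply: measurableT_comp => //; exact: measurable_funM.
Qed.

(* The two densities differ at [0] only. *)
Let exponential_prob_open r (B : set R) : measurable B ->
  exponential_prob r B = (\int[mu]_(u in B) (open_exponential_pdf r u)%:E)%E.
Proof.
move=> mB; apply: ae_eq_integral => //.
- apply: measurable_funTS; apply/measurable_EFinP; exact: measurable_exponential_pdf.
- apply: measurable_funTS; apply/measurable_EFinP; exact: measurable_open_exponential_pdf.
- exists [set (0 : R)]; split => //; first exact: lebesgue_measure_set1.
  move=> u /=; apply: contra_notP => /eqP u0 _; congr EFin.
  rewrite /open_exponential_pdf indicE mem_setE in_itv/= andbT.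
  have [u_gt0|] := ltP 0 u; first by rewrite mul1r exponential_pdfE// ltW.
  by rewrite le_eqVlt (negbTE u0)/= => u_lt0; rewrite mul0r lt0_exponential_pdf.
Qed.

Lemma normal_pdf_exponential_tilt r eta u v : 0 < eta ->
  normal_pdf (eta ^+ 2 * u) eta v * expR (- r * u) =
  eta ^- 2 * expR (- r * (v / eta ^+ 2) + (r / eta) ^+ 2 / 2) *
  normal_pdf (eta^-1 * (eta^-1 * (v - r))) eta^-1 u.
Proof.
move=> eta0; have etaN0 : eta != 0 by rewrite gt_eqF.
have eta2 : 0 < eta ^+ 2 by rewrite exprn_gt0.
have etaVN0 : eta^-1 != 0 by rewrite invr_eq0.
have likelihoodE : normal_pdf (eta ^+ 2 * u) eta v =
    eta ^- 2 * normal_pdf (v / eta ^+ 2) eta^-1 u.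
  rewrite [in RHS]normal_pdfC// -(normal_pdf_affine u 0 (v / eta ^+ 2) eta2 etaVN0).
  by rewrite mulKf ?gt_eqF// !addr0; congr normal_pdf; field.
rewrite likelihoodE -[LHS]mulrA -[RHS]mulrA (mulrC (normal_pdf _ _ _)) normal_pdf_tilt//.
by congr (_ * (expR _ * normal_pdf _ _ _)); field.
Qed.

Let posterior_scale r eta v :=
  r * (eta ^- 2 * expR (- r * (v / eta ^+ 2) + (r / eta) ^+ 2 / 2)) *
  std_Phi (eta^-1 * (eta^-1 * (v - r)) / eta^-1).

Let posterior_scale_ge0 r eta v : 0 <= r -> 0 <= posterior_scale r eta v.
Proof.
by move=> r0; rewrite !mulr_ge0 ?invr_ge0 ?exprn_even_ge0 ?expR_ge0 ?std_Phi_ge0.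
Qed.

Let joint_densityE r eta u v : 0 < eta ->
  normal_pdf (eta ^+ 2 * u) eta v * open_exponential_pdf r u =
  posterior_scale r eta v * tn_pdf (eta^-1 * (eta^-1 * (v - r))) (eta^-1 ^+ 2) u.
Proof.
move=> eta0; have etaV0 : 0 < eta^-1 by rewrite invr_gt0.
rewrite tn_pdfE// /open_exponential_pdf /posterior_scale mulrCA [RHS]mulrCA.
congr (_ * _); rewrite [LHS]mulrCA normal_pdf_exponential_tilt//.
have := std_Phi_gt0 (eta^-1 * (eta^-1 * (v - r)) / eta^-1).
move: (std_Phi _) (expR _) (normal_pdf _ _ _) => Phi E N Phi0.
by field; rewrite !gt_eqF.
Qed.

Section posterior.
Context d (T : measurableType d) (P : probability T R).
Variables (U X : T -> R) (eta : R).
Hypotheses (mU : measurable_fun setT U) (mX : measurable_fun setT X) (eta0 : 0 < eta).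
Hypothesis indep_UX : independent P U X.
Hypothesis lawX : forall A, measurable A -> P (X @^-1` A) = normal_prob 0 eta A.

Lemma exponential_normal_posterior r (B C : set R) : 0 <= r ->
  (forall A, measurable A -> P (U @^-1` A) = exponential_prob r A) ->
  measurable B -> measurable C ->
  \int[P]_(t in (fun t => eta ^+ 2 * U t + X t) @^-1` C)
    (\1_B (U t) - posterior_prob r eta B (eta ^+ 2 * U t + X t)) = 0.
Proof.
move=> r0 lawU mB mC; have etaN0 : eta != 0 by rewrite gt_eqF.
have etaV0 : 0 < eta^-1 by rewrite invr_gt0.
pose e := open_exponential_pdf r.
have e0 u : 0 <= e u by rewrite mulr_ge0// mulr_ge0// expR_ge0.
have me : measurable_fun setT e by exact: measurable_open_exponential_pdf.
have lawUe A : measurable A -> P (U @^-1` A) = (\int[mu]_(u in A) (e u)%:E)%E.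
  by move=> mA; rewrite lawU// exponential_prob_open.
pose w (z : R * R) := normal_pdf (eta ^+ 2 * z.1) eta z.2 * e z.1.
apply: (@bayes _ _ _ P U (fun t => eta ^+ 2 * U t + X t) w _ _ _ _ _ B
  (posterior_prob r eta B)) => //.
- by apply: measurable_funD => //; exact: measurable_funM.
- have mc1 : measurable_fun setT (fun z : R * R => eta ^+ 2 * z.1) by exact: measurable_funM.
  apply: measurable_funM; last exact: measurableT_comp me measurable_fst.
  exact: measurableT_comp (measurable_normal_pdf_pair etaN0)
    (measurable_fun_pair mc1 measurable_snd).
- by move=> z; rewrite mulr_ge0// normal_pdf_ge0.
- move=> G mG G0; exact: ge0_integral_normal_shift mU mX indep_UX me e0 lawUe etaN0 lawX mG G0.
- exact: bounded_measurable_posterior_prob.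
- by move=> v; exact: fine_tn_prob_ge0.
- move=> v; have scaleE A : measurable A -> (\int[mu]_(u in A) (w (u, v))%:E =
      (posterior_scale r eta v)%:E *
      tn_prob (eta^-1 * (eta^-1 * (v - r))) (eta^-1 ^+ 2) A)%E.
    move=> mA; rewrite /tn_prob -ge0_integralZl//.
    + by apply: eq_integral => u _; rewrite /w joint_densityE.
    + apply: measurable_funTS; apply/measurable_EFinP; exact: measurable_tn_pdf.
    + by move=> u _; rewrite lee_fin tn_pdf_ge0.
    + by rewrite lee_fin posterior_scale_ge0.
  by rewrite !scaleE// tn_prob_setT// mule1 /posterior_prob fineK ?tn_prob_fin_num// muleC.
Qed.

End posterior.
End exponential_normal_posterior.

Section column_vectors.
Context {R : realType} {p : nat}.
Implicit Types (a b z : 'cV[R]_p) (M : 'M[R]_p).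

Definition dot a z : R := sc (a^T *m z).

Lemma dotE a z : dot a z = \sum_i a i ord0 * z i ord0.
Proof. by rewrite /dot /sc mxE; apply: eq_bigr => i _; rewrite mxE. Qed.

Lemma dotC a z : dot a z = dot z a.
Proof. by rewrite !dotE; apply: eq_bigr => i _; rewrite mulrC. Qed.

Lemma dot0l z : dot 0 z = 0.
Proof. by rewrite /dot /sc trmx0 mul0mx mxE. Qed.

Lemma dotDl a b z : dot (a + b) z = dot a z + dot b z.
Proof. by rewrite /dot /sc linearD mulmxDl mxE. Qed.

Lemma dotZl (c : R) a z : dot (c *: a) z = c * dot a z.
Proof. by rewrite /dot /sc linearZ -scalemxAl mxE. Qed.

Lemma dotDr a b z : dot z (a + b) = dot z a + dot z b.
Proof. by rewrite !(dotC z) dotDl. Qed.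

Lemma dotZr (c : R) a z : dot z (c *: a) = c * dot z a.
Proof. by rewrite !(dotC z) dotZl. Qed.

Lemma dot_mulmx M a z : dot a (M *m z) = dot (M^T *m a) z.
Proof. by rewrite /dot trmx_mul trmxK mulmxA. Qed.

Lemma measurable_dot d (T : measurableType d) (Z : T -> 'cV[R]_p) a :
  (forall i, measurable_fun setT (fun t => Z t i ord0)) ->
  measurable_fun setT (fun t => dot a (Z t)).
Proof.
move=> mZ; under eq_fun do rewrite dotE.
by apply: measurable_sum => i; exact: measurable_funM.
Qed.

Lemma measurable_scaleD d (T : measurableType d) (U : T -> R) (Z : T -> 'cV[R]_p) a :
  measurable_fun setT U -> (forall i, measurable_fun setT (fun t => Z t i ord0)) ->
  forall i, measurable_fun setT (fun t => (U t *: a + Z t) i ord0).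
Proof.
move=> mU mZ i; under eq_fun do rewrite !mxE.
by apply: measurable_funD => //; exact: measurable_funM.
Qed.

Lemma measurable_mulmxD d (T : measurableType d) (Z : T -> 'cV[R]_p) a M :
  (forall i, measurable_fun setT (fun t => Z t i ord0)) ->
  forall i, measurable_fun setT (fun t => (a + M *m Z t) i ord0).
Proof.
move=> mZ i; under eq_fun do rewrite !mxE.
by apply: measurable_funD => //; apply: measurable_sum => k; exact: measurable_funM.
Qed.

Lemma spd_dot_gt0 M a : spd M -> a != 0 -> 0 < dot a (M *m a).
Proof. by move=> [_ Mpos] /Mpos; rewrite /dot mulmxA. Qed.

End column_vectors.

Section independent_vector.
Context d (T : measurableType d) (R : realType) (P : probability T R) (p : nat).
Variables (U : T -> R) (Z : T -> 'cV[R]_p).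
Hypothesis mU : measurable_fun setT U.
Hypothesis mZ : forall i, measurable_fun setT (fun t => Z t i ord0).
Hypothesis indep_rect : forall (B : set R) (C : 'I_p -> set R), measurable B ->
  (forall i, measurable (C i)) ->
  P (U @^-1` B `&` Z @^-1` rect C) = (P (U @^-1` B) * P (Z @^-1` rect C))%E.

Lemma measurable_preimage_rect (C : 'I_p -> set R) : (forall i, measurable (C i)) ->
  measurable (Z @^-1` rect C).
Proof.
move=> mC; rewrite (_ : _ @^-1` _ = \bigcap_(i : 'I_p) ((fun t => Z t i ord0) @^-1` C i)).
  apply: fin_bigcap_measurable => // i _.
  by rewrite -[X in measurable X]setTI; exact: mZ.
by apply/seteqP; split => t /= ZC i; [move=> _|]; exact: ZC.
Qed.

Lemma independent_dot (a : 'cV[R]_p) : independent P U (fun t => dot a (Z t)).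
Proof.
move=> A B mA mB.
pose G := [set Z @^-1` rect C | C in [set C : 'I_p -> set R | forall i, measurable (C i)]].
have mUA : measurable (U @^-1` A) by rewrite -[X in measurable X]setTI; exact: mU.
apply: (independent_g_sigma (G := G) mUA).
- by move=> _ [C mC <-]; exact: measurable_preimage_rect.
- move=> _ _ [C mC <-] [C' mC' <-]; exists (fun i => C i `&` C' i).
    by move=> i; exact: measurableI.
  by apply/seteqP; split => t /= => [CC'|[CZ C'Z] i]; [split=> i; have [] := CC' i|split].
- by move=> _ [C mC <-]; exact: indep_rect.
- rewrite -[X in <<s _ >> X]setTI.
  apply: (@measurable_dot _ _ _ (g_sigma_algebraType G) Z a) => // i _ D mD.
  apply: sub_gen_smallest; exists (fun j => if j == i then D else setT).
    by move=> j; case: ifP.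
  rewrite setTI; apply/seteqP; split => t /= => [/(_ i)|Dt j]; first by rewrite eqxx.
  by case: eqP => // ->.
Qed.

End independent_vector.

Section exponential_normal_mixture.
Context d (T : measurableType d) (R : realType) (P : probability T R) (p : nat).
Variables (G : 'M[R]_p) (de b : 'cV[R]_p) (r eta : R) (U : T -> R) (Z : T -> 'cV[R]_p).
Hypotheses (spdG : spd G) (eta0 : 0 < eta) (Gb : G *m b = de) (bde : dot b de = eta ^+ 2).
Hypothesis r0 : 0 <= r.
Hypothesis mU : measurable_fun setT U.
Hypothesis mZ : forall i, measurable_fun setT (fun t => Z t i ord0).
Hypothesis lawU : forall B : set R, measurable B -> P (U @^-1` B) = exponential_prob r B.
Hypothesis lawZ : forall a : 'cV[R]_p, a != 0 -> forall B : set R, measurable B ->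
  P ((fun t => dot a (Z t)) @^-1` B) = normal_prob 0 (Num.sqrt (sc (a^T *m G *m a))) B.
Hypothesis indep_UZ : forall a : 'cV[R]_p, independent P U (fun t => dot a (Z t)).

Let qf a := sc (a^T *m G *m a).
Let W t := U t *: de + Z t.
Let S t := dot b (W t).

Let qfE a : qf a = dot a (G *m a). Proof. by rewrite /dot mulmxA. Qed.

Let dot_W a t : dot a (W t) = dot a de * U t + dot a (Z t).
Proof. by rewrite /W dotDr dotZr mulrC. Qed.

Let measurable_dot_W a : measurable_fun setT (fun t => dot a (W t)).
Proof.
under eq_fun do rewrite dot_W.
by apply: measurable_funD; [exact: measurable_funM|exact: measurable_dot].
Qed.

Let mean_cos_dot_Z a th : \int[P]_t cos (dot a (Z t) + th) = expR (- qf a / 2) * cos th.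
Proof.
have [->|a0] := eqVneq a 0.
  under eq_Rintegral do rewrite dot0l add0r.
  by rewrite Rintegral_probability_cst qfE dot0l oppr0 mul0r expR0 mul1r.
have qf0 : 0 < qf a by exact: spdG.2.
pose rvX : {RV P >-> measurableTypeR R} :=
  HB.pack (fun t => dot a (Z t))
    (isMeasurableFun.Build _ _ _ (measurableTypeR R) _ (measurable_dot a mZ)).
transitivity (\int[distribution P rvX]_x cos (1 * x + th)).
  rewrite -(Rintegral_distribution rvX).
    by apply: eq_Rintegral => t _; rewrite mul1r.
  exact: bounded_measurable_cos (measurable_affine 1 th).
transitivity (\int[normal_prob 0 (Num.sqrt (qf a))]_x cos (1 * x + th)).
  by congr fine; apply: eq_measure_integral => A mA _; exact: lawZ.
by rewrite normal_prob_cos ?gt_eqF ?sqrtr_gt0// mulr1 sqr_sqrtr// ltW.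
Qed.

Let mean_cos_dot_W f a th : bounded_measurable f ->
  \int[P]_t (f (U t) * cos (dot a (W t) + th)) =
  expR (- qf a / 2) * \int[P]_t (f (U t) * cos (dot a de * U t + th)).
Proof.
move=> bf; have mX := measurable_dot a mZ.
pose g (z : R * R) := f z.1 * cos (z.2 + (dot a de * z.1 + th)).
have bg : bounded_measurable g.
  apply: bounded_measurableM; first exact: bounded_measurable_comp bf measurable_fst.
  apply: bounded_measurable_cos; apply: measurable_funD => //.
  by apply: measurable_funD => //; exact: measurable_funM.
transitivity (\int[P]_t g (U t, dot a (Z t))).
  by apply: eq_Rintegral => t _; rewrite dot_W /g/=; congr (_ * cos _); ring.
rewrite (Rintegral_independent mU mX (@indep_UZ a) bg) -bounded_RintegralZ; last first.
  apply: bounded_measurableM; first exact: bounded_measurable_comp bf mU.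
  by apply: bounded_measurable_cos; apply: measurable_funD => //; exact: measurable_funM.
apply: eq_Rintegral => t _; rewrite /g/= bounded_RintegralZ; last first.
  by apply: bounded_measurable_cos; exact: measurable_funD.
by rewrite mean_cos_dot_Z mulrCA.
Qed.

(* [dot a (W t)] is [slope a * S t] plus a normal variable of variance [resid a],
   independent of [(U t, S t)]. *)
Let slope a := dot a de / eta ^+ 2.
Let resid a := qf a - slope a ^+ 2 * eta ^+ 2.

Let eta2_neq0 : eta ^+ 2 != 0. Proof. by rewrite sqrf_eq0 gt_eqF. Qed.

Let slopeD a s : slope (a + s *: b) = slope a + s.
Proof. by rewrite /slope dotDl dotZl bde mulrDl mulfK. Qed.

Let residD a s : resid (a + s *: b) = resid a.
Proof.
rewrite /resid slopeD !qfE linearD linearZ/= Gb !(dotDl, dotDr, dotZl, dotZr) bde.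
have -> : dot b (G *m a) = dot a de by rewrite dot_mulmx spdG.1 Gb dotC.
have -> : dot a de = slope a * eta ^+ 2 by rewrite divfK.
by ring.
Qed.

Let qfZ s : qf (s *: b) = s ^+ 2 * eta ^+ 2.
Proof. by rewrite qfE linearZ/= Gb dotZl dotZr bde; ring. Qed.

Let sufficiency_U f a th : bounded_measurable f ->
  \int[P]_t (f (U t) * cos (dot a (W t) + th)) =
  expR (- resid a / 2) * \int[P]_t (f (U t) * cos (slope a * S t + th)).
Proof.
move=> bf; under [in RHS]eq_Rintegral do rewrite /S -dotZl.
rewrite !mean_cos_dot_W// [RHS]mulrA -expRD dotZl bde divfK//.
by congr (expR _ * _); rewrite qfZ /resid; field.
Qed.

Let measurable_S : measurable_fun setT S. Proof. exact: measurable_dot_W. Qed.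

Let bounded_cos_W a th : bounded_measurable (fun t => cos (dot a (W t) + th)).
Proof. by apply: bounded_measurable_cos; exact: measurable_funD. Qed.

Let bounded_cos_S s th : bounded_measurable (fun t => cos (s * S t + th)).
Proof. exact: bounded_measurable_comp (bounded_measurable_cos (measurable_affine s th)) _. Qed.

Let sufficiency_defect a th t :=
  cos (dot a (W t) + th) - expR (- resid a / 2) * cos (slope a * S t + th).

Let bounded_sufficiency_defect a th : bounded_measurable (sufficiency_defect a th).
Proof. by apply: bounded_measurableB => //; exact: bounded_measurableZ. Qed.

Let mean_sufficiency_defect a th : \int[P]_t sufficiency_defect a th t = 0.
Proof.
rewrite bounded_RintegralB//; last exact: bounded_measurableZ.
rewrite bounded_RintegralZ//.
have := sufficiency_U a th (bounded_measurable_cst R (1 : R)).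
under eq_Rintegral do rewrite mul1r.
under [in X in _ = X -> _]eq_Rintegral do rewrite mul1r.
by move=> ->; rewrite subrr.
Qed.

Let sufficiency_defect_mul_cos a th s ph t :
  sufficiency_defect a th t * cos (s * S t + ph) =
  2^-1 * sufficiency_defect (a + s *: b) (th + ph) t +
  2^-1 * sufficiency_defect (a + - s *: b) (th - ph) t.
Proof.
rewrite /sufficiency_defect !residD !slopeD mulrBl -mulrA !mul_cos !dotDl !dotZl -/(S t).
have -> : dot a (W t) + th + (s * S t + ph) = dot a (W t) + s * S t + (th + ph) by ring.
have -> : dot a (W t) + th - (s * S t + ph) = dot a (W t) + - s * S t + (th - ph) by ring.
have -> : slope a * S t + th + (s * S t + ph) = (slope a + s) * S t + (th + ph) by ring.
have -> : slope a * S t + th - (s * S t + ph) = (slope a + - s) * S t + (th - ph) by ring.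
by ring.
Qed.

Let sufficiency_defect_preimage a th (C : set R) : measurable C ->
  \int[P]_(t in S @^-1` C) sufficiency_defect a th t = 0.
Proof.
apply: fourier_uniqueness => // s ph.
under eq_Rintegral do rewrite sufficiency_defect_mul_cos.
rewrite bounded_RintegralD; [|exact: bounded_measurableZ|exact: bounded_measurableZ].
by rewrite !bounded_RintegralZ// !mean_sufficiency_defect mulr0 addr0.
Qed.

Let sufficiency_S f a th : bounded_measurable f ->
  \int[P]_t (f (S t) * cos (dot a (W t) + th)) =
  expR (- resid a / 2) * \int[P]_t (f (S t) * cos (slope a * S t + th)).
Proof.
move=> bf; have bfS := bounded_measurable_comp bf measurable_S.
have := Rintegral0_comp (bounded_sufficiency_defect a th) measurable_S bf
  (@sufficiency_defect_preimage a th).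
have defectE t : sufficiency_defect a th t * f (S t) =
    f (S t) * cos (dot a (W t) + th) -
    expR (- resid a / 2) * (f (S t) * cos (slope a * S t + th)).
  by rewrite /sufficiency_defect; ring.
under eq_Rintegral do rewrite defectE.
rewrite bounded_RintegralB; last 2 first.
- exact: bounded_measurableM.
- exact/bounded_measurableZ/bounded_measurableM.
rewrite bounded_RintegralZ; last exact: bounded_measurableM.
by move=> /eqP; rewrite subr_eq0 => /eqP.
Qed.

Let posterior_S (B C : set R) : measurable B -> measurable C ->
  \int[P]_(t in S @^-1` C) (\1_B (U t) - posterior_prob r eta B (S t)) = 0.
Proof.
move=> mB mC; have lawX A : measurable A ->
    P ((fun t => dot b (Z t)) @^-1` A) = normal_prob 0 eta A.
  move=> mA; have b0 : b != 0.
    by apply: contra_neq eta2_neq0 => b0; rewrite -bde b0 dot0l.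
  by rewrite (lawZ b0 mA) -/(qf b) qfE Gb bde sqrtr_sqr gtr0_norm.
have SE : S = fun t => eta ^+ 2 * U t + dot b (Z t).
  by apply/funext => t; rewrite /S dot_W bde.
rewrite SE.
by have := exponential_normal_posterior mU (measurable_dot b mZ) eta0 (@indep_UZ b) lawX r0
  lawU mB mC.
Qed.

Let posterior_cos (B : set R) a th : measurable B ->
  \int[P]_t ((\1_B (U t) - posterior_prob r eta B (S t)) * cos (dot a (W t) + th)) = 0.
Proof.
move=> mB; have bB := bounded_measurable_indic R mB.
have bK := bounded_measurable_posterior_prob r eta0 mB.
have bBU := bounded_measurable_comp bB mU.
have bKS := bounded_measurable_comp bK measurable_S.
have H_slope : \int[P]_t ((\1_B (U t) - posterior_prob r eta B (S t)) *
    cos (slope a * S t + th)) = 0.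
  apply: (Rintegral0_comp (f := fun x => cos (slope a * x + th)) _ measurable_S).
  - exact: bounded_measurableB.
  - exact: bounded_measurable_cos (measurable_affine _ _).
  - by move=> C mC; exact: posterior_S.
have mulBl (g : T -> R) : bounded_measurable g ->
    \int[P]_t ((\1_B (U t) - posterior_prob r eta B (S t)) * g t) =
    \int[P]_t (\1_B (U t) * g t) - \int[P]_t (posterior_prob r eta B (S t) * g t).
  move=> bg; under eq_Rintegral do rewrite mulrBl.
  by rewrite bounded_RintegralB//; exact: bounded_measurableM.
rewrite mulBl// sufficiency_U// sufficiency_S// -mulrBr -mulBl//.
by rewrite H_slope mulr0.
Qed.

Theorem exponential_normal_mixture_posterior (M : 'M[R]_p) (xi : 'cV[R]_p) (B : set R)
    (C : 'I_p -> set R) : measurable B -> (forall i, measurable (C i)) ->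
  \int[P]_(t in (fun t => xi + M *m (U t *: de + Z t)) @^-1` rect C)
    (\1_B (U t) - posterior_prob r eta B (dot b (U t *: de + Z t))) = 0.
Proof.
move=> mB mC.
apply: (fourier_uniqueness_fin (X := fun i t => (xi + M *m W t) i ord0)) => //.
- exact: measurable_mulmxD (measurable_scaleD de mU mZ).
- apply: bounded_measurableB.
    exact: bounded_measurable_comp (bounded_measurable_indic R mB) mU.
  exact: bounded_measurable_comp (bounded_measurable_posterior_prob r eta0 mB) measurable_S.
move=> al th; pose a : 'cV[R]_p := \col_i al i.
rewrite -[RHS](posterior_cos (M^T *m a) (dot a xi + th) mB).
apply: eq_Rintegral => t _; congr (_ * cos _).
rewrite -dot_mulmx addrA (addrC (dot _ _)) -dotDr dotE.
by congr (_ + _); apply: eq_bigr => i _; rewrite [in RHS]mxE.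
Qed.

End exponential_normal_mixture.

Section scale_matrices.
Context {R : realType} {p : nat}.
Implicit Types (M Om : 'M[R]_p) (de : 'cV[R]_p).

Lemma spd_unitmx M : spd M -> M \in unitmx.
Proof.
move=> [_ Mpos]; rewrite unitmxE unitfE; apply/negP => /det0P[v v0 vM].
have := Mpos v^T; rewrite trmxK vM mul0mx /sc mxE ltxx => /(_ _)/negP; apply=> //.
by apply: contraNneq v0 => /(congr1 trmx); rewrite trmxK trmx0 => ->.
Qed.

Lemma spd_diag_gt0 M i : spd M -> 0 < M i i.
Proof.
move=> [_ Mpos]; have := Mpos (delta_mx i ord0).
rewrite trmx_delta -rowE -colE /sc !mxE; apply.
by apply/eqP => /matrixP/(_ i ord0); rewrite !mxE !eqxx => /eqP; rewrite oner_eq0.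
Qed.

Lemma omega_of_unit Om : spd Om -> omega_of Om \in unitmx.
Proof.
move=> spdO.
have omV : omega_of Om *m diag_mx (\row_j (Num.sqrt (Om j j))^-1) = 1%:M.
  rewrite mul_mx_diag; apply/matrixP => i j; rewrite !mxE.
  case: eqVneq => [<-|]; last by rewrite mul0r.
  by rewrite divff// gt_eqF// sqrtr_gt0 spd_diag_gt0.
by have [] := mulmx1_unit omV.
Qed.

Lemma SigmaYE Om de : spd Om ->
  SigmaY Om de = omega_of Om *m (Ombar Om - de *m de^T) *m omega_of Om.
Proof.
move=> /omega_of_unit uom; rewrite /SigmaY mulmxBr mulmxBl /Ombar !mulmxA.
by rewrite mulmxV// mul1mx mulmxKV.
Qed.

Lemma invmx_SigmaY Om de : spd Om -> spd (Ombar Om - de *m de^T) ->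
  invmx (SigmaY Om de) =
  invmx (omega_of Om) *m invmx (Ombar Om - de *m de^T) *m invmx (omega_of Om).
Proof.
move=> spdO spdG; have uom := omega_of_unit spdO; have uG := spd_unitmx spdG.
rewrite SigmaYE//; set G := Ombar Om - _ in uG *; set om := omega_of Om in uom *.
have SigmaV : om *m G *m om *m (invmx om *m invmx G *m invmx om) = 1%:M.
  by rewrite !mulmxA mulmxK// mulmxK// mulmxV.
have [uSigma _] := mulmx1_unit SigmaV.
by rewrite -[LHS]mulmx1 -SigmaV mulKmx.
Qed.

End scale_matrices.

Section conditional_law.
Context {R : realType} {p : nat}.
Variables (xi : 'cV[R]_p) (Om : 'M[R]_p) (de : 'cV[R]_p).
Hypotheses (spdO : spd Om) (spdG : spd (Ombar Om - de *m de^T)) (de0 : de != 0).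

Local Notation G := (Ombar Om - de *m de^T).
Local Notation om := (omega_of Om).
Local Notation eta := (eta_of Om de).

Definition regression : 'cV[R]_p := invmx G *m de.

Lemma mulmx_regression : G *m regression = de.
Proof. by rewrite mulKVmx// spd_unitmx. Qed.

Let trmx_regression : regression^T = de^T *m invmx G.
Proof. by rewrite trmx_mul trmx_inv spdG.1. Qed.

Let dot_regression_gt0 : 0 < dot regression de.
Proof.
rewrite -[X in dot _ X]mulmx_regression spd_dot_gt0//.
by apply: contraNneq de0 => b0; rewrite -mulmx_regression b0 mulmx0.
Qed.

Let eta_ofE : eta = Num.sqrt (dot regression de).
Proof.
rewrite /eta_of invmx_SigmaY// /dot trmx_regression; congr (Num.sqrt (sc _)).
by rewrite !mulmxA mulmxK ?omega_of_unit// mulmxKV ?omega_of_unit.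
Qed.

Lemma eta_of_gt0 : 0 < eta. Proof. by rewrite eta_ofE sqrtr_gt0. Qed.

Lemma dot_regression : dot regression de = eta ^+ 2.
Proof. by rewrite eta_ofE sqr_sqrtr// ltW. Qed.

Lemma A_ofE w : A_of xi Om de (xi + om *m w) = eta^-1 * (dot regression w - 1).
Proof.
rewrite /A_of invmx_SigmaY// /dot trmx_regression (addrC xi) addrK.
by congr (_ * (sc _ - 1)); rewrite !mulmxA mulmxK ?mulmxKV ?omega_of_unit.
Qed.

Lemma cond_kernelE w (B : set R) : measurable B ->
  cond_kernel xi Om de (xi + om *m w) B = (posterior_prob 1 eta B (dot regression w))%:E.
Proof.
move=> mB; have etaV0 : 0 < eta^-1 by rewrite invr_gt0 eta_of_gt0.
by rewrite /cond_kernel A_ofE -exprVn [RHS]fineK//; exact: tn_prob_fin_num.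
Qed.

Lemma cond_moment1 y : let A := A_of xi Om de y in
  cond_moment xi Om de 1 y = (eta^-1 * (A + std_phi A / std_Phi A))%:E.
Proof.
move=> A; have etaV0 : 0 < eta^-1 by rewrite invr_gt0 eta_of_gt0.
by rewrite /cond_moment -exprVn tn_moment1// -/A mulrAC mulfV ?gt_eqF// mul1r mulrDr.
Qed.

Lemma cond_moment_rec y k : cond_moment xi Om de k.+2 y =
  ((A_of xi Om de y * eta^-1)%:E * cond_moment xi Om de k.+1 y +
   (k.+1%:R * eta ^- 2)%:E * cond_moment xi Om de k y)%E.
Proof.
have etaV0 : 0 < eta^-1 by rewrite invr_gt0 eta_of_gt0.
by rewrite /cond_moment -exprVn tn_moment_rec// (mulrC (A_of _ _ _ _)).
Qed.

End conditional_law.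

Theorem theorem8 (R : realType) (d : measure_display) (T : measurableType d)
  (P : probability T R) (p : nat)
  (xi : 'cV[R]_p) (Om : 'M[R]_p) (de : 'cV[R]_p)
  (U : T -> R) (Z : T -> 'cV[R]_p) :
  spd Om ->
  spd (Ombar Om - de *m de^T) ->
  de != 0 ->
  (* U is standard exponential *)
  measurable_fun [set: T] U ->
  (forall B : set R, measurable B -> P (U @^-1` B) = exponential_prob 1 B) ->
  (* Z ~ N_p(0, Ombar - de de^T), stated via one-dimensional projections *)
  (forall i : 'I_p, measurable_fun [set: T] (fun t => Z t i ord0)) ->
  (forall a : 'cV[R]_p, a != 0 -> forall B : set R, measurable B ->
     P ((fun t => sc (a^T *m Z t)) @^-1` B) =
     normal_prob 0 (Num.sqrt (sc (a^T *m (Ombar Om - de *m de^T) *m a))) B) ->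
  (* U and Z are independent *)
  (forall (B : set R) (C : 'I_p -> set R), measurable B ->
     (forall i, measurable (C i)) ->
     P (U @^-1` B `&` Z @^-1` rect C) = (P (U @^-1` B) * P (Z @^-1` rect C))%E) ->
  let Y := fun t => xi + omega_of Om *m (U t *: de + Z t) in
  let eta := eta_of Om de in
  (* the conditional law of U given Y = y is TN(eta^{-1} A(y), eta^{-2}, (0,oo)) *)
  (forall (B : set R) (C : 'I_p -> set R), measurable B ->
     (forall i, measurable (C i)) ->
     P (U @^-1` B `&` Y @^-1` rect C) =
     (\int[P]_(t in Y @^-1` rect C) cond_kernel xi Om de (Y t) B)%E) /\
  (forall y : 'cV[R]_p,
     let A := A_of xi Om de y in
     cond_moment xi Om de 1 y = (eta^-1 * (A + std_phi A / std_Phi A))%:E /\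
     (forall k : nat, (2 <= k)%N ->
        cond_moment xi Om de k y =
        ((A * eta^-1)%:E * cond_moment xi Om de k.-1 y +
         ((k.-1)%:R * eta ^- 2)%:E * cond_moment xi Om de k.-2 y)%E)).
Proof.
move=> spdO spdG de0 mU lawU mZ lawZ indep_UZ Y eta.
split; last first.
  move=> y A; split; first exact: cond_moment1.
  by case=> [|[|k]]// _; exact: cond_moment_rec.
move=> B C mB mC.
have mUB : measurable (U @^-1` B) by rewrite -[X in measurable X]setTI; exact: mU.
have mW := measurable_scaleD de mU mZ.
under eq_integral do rewrite cond_kernelE//.
apply: measure_setI_Rintegral => //.
- exact: measurable_preimage_rect (measurable_mulmxD xi (omega_of Om) mW) _ mC.
- apply: bounded_measurable_comp (measurable_dot _ mW).
  by apply: bounded_measurable_posterior_prob => //; exact: eta_of_gt0.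
exact: (exponential_normal_mixture_posterior spdG (eta_of_gt0 spdO spdG de0)
  (mulmx_regression spdG) (dot_regression spdO spdG de0) ler01 mU mZ lawU lawZ
  (independent_dot mU mZ indep_UZ) _ _ mB mC).
Qed.
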